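(* Let $K\subset\mathbb{R}^d$, $K'\subset\mathbb{R}^{d'}$ be compact, $g:\mathbb{R}\to\mathbb{R}$ continuous and not a polynomial, $F:C(K)\to C(K')$ a continuous operator and $E\subset C(K)$ compact. Then for every $\epsilon>0$ there exist a sample factorization $(\Delta_E,\Delta^*_E)$ of $E$ of some order $M_1$, a sample factorization $(\Delta_{F[E]},\Delta^*_{F[E]})$ of $F[E]$ of some order $M_2$, an integer $N$, and affine maps $T_1:\mathbb{R}^{M_1}\to\mathbb{R}^N$, $T_2:\mathbb{R}^N\to\mathbb{R}^{M_2}$ such that $$\sup_{f\in E}\big\|\Delta^*_{F[E]}\circ T_2\circ g\circ T_1\circ\Delta_E(f)-F(f)\big\|_\infty<\epsilon.$$
   Context: A sample factorization of order $M$ and error $\delta$ for a subset $\mathcal{X}$ of a normed space $V$ is a pair of continuous linear maps $\Delta:V\to\mathbb{R}^M$, $\Delta^*:\mathbb{R}^M\to V$ with $\Delta\circ\Delta^*=\mathrm{id}_{\mathbb{R}^M}$ and $\sup_{f\in\mathcal{X}}\|\Delta^*\Delta f-f\|_V<\delta$. $C(K)$ carries the sup norm; $g$ acts coordinatewise. *)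

(* Defs.v *)
From Stdlib Require Import Reals List.
From Stdlib Require Vectors.Fin.
Open Scope R_scope.

Definition vecR (n : nat) := Fin.t n -> R.

Definition compact_set {d : nat} (K : vecR d -> Prop) : Prop :=
  forall x : nat -> vecR d, (forall n, K (x n)) ->
  exists (phi : nat -> nat) (y : vecR d),
    (forall n, (phi n < phi (S n))%nat) /\ K y /\
    forall eps, 0 < eps -> exists N, forall n, (N <= n)%nat ->
      forall i, Rabs (x (phi n) i - y i) < eps.

Definition ptK {d : nat} (K : vecR d -> Prop) := { x : vecR d | K x }.

Definition cont_on {d : nat} {K : vecR d -> Prop} (f : ptK K -> R) : Prop :=
  forall x : ptK K, forall eps, 0 < eps -> exists del, 0 < del /\
    forall y : ptK K, (forall i, Rabs (proj1_sig y i - proj1_sig x i) < del) ->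
      Rabs (f y - f x) < eps.

Definition CK {d : nat} (K : vecR d -> Prop) := { f : ptK K -> R | cont_on f }.

Definition ev {d : nat} {K : vecR d -> Prop} (f : CK K) (x : ptK K) : R :=
  proj1_sig f x.

Definition sup_lt {d : nat} (K : vecR d -> Prop) (u : ptK K -> R) (r : R) : Prop :=
  exists c, c < r /\ forall x : ptK K, Rabs (u x) <= c.

Definition compact_CK {d : nat} {K : vecR d -> Prop} (E : CK K -> Prop) : Prop :=
  forall f : nat -> CK K, (forall n, E (f n)) ->
  exists (phi : nat -> nat) (h : CK K),
    (forall n, (phi n < phi (S n))%nat) /\ E h /\
    forall eps, 0 < eps -> exists N, forall n, (N <= n)%nat ->
      sup_lt K (fun x => ev (f (phi n)) x - ev h x) eps.

Definition cont_op {d d' : nat} {K : vecR d -> Prop} {K' : vecR d' -> Prop}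
  (F : CK K -> CK K') : Prop :=
  forall f eps, 0 < eps -> exists del, 0 < del /\
    forall h, sup_lt K (fun x => ev h x - ev f x) del ->
      sup_lt K' (fun x => ev (F h) x - ev (F f) x) eps.

Definition clin_sample {d : nat} {K : vecR d -> Prop} {M : nat}
  (D : CK K -> vecR M) : Prop :=
  (forall f g h : CK K, (forall x, ev h x = ev f x + ev g x) ->
     forall i, D h i = D f i + D g i) /\
  (forall (a : R) (f h : CK K), (forall x, ev h x = a * ev f x) ->
     forall i, D h i = a * D f i) /\
  (forall f eps, 0 < eps -> exists del, 0 < del /\
    forall h, sup_lt K (fun x => ev h x - ev f x) del ->
      forall i, Rabs (D h i - D f i) < eps).

Definition clin_recon {d : nat} {K : vecR d -> Prop} {M : nat}
  (Ds : vecR M -> CK K) : Prop :=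
  (forall v w : vecR M, forall x,
     ev (Ds (fun i => v i + w i)) x = ev (Ds v) x + ev (Ds w) x) /\
  (forall (a : R) (v : vecR M), forall x,
     ev (Ds (fun i => a * v i)) x = a * ev (Ds v) x) /\
  (forall v eps, 0 < eps -> exists del, 0 < del /\
    forall w : vecR M, (forall i, Rabs (w i - v i) < del) ->
      sup_lt K (fun x => ev (Ds w) x - ev (Ds v) x) eps).

Definition sample_factorization {d : nat} (K : vecR d -> Prop) (X : CK K -> Prop)
  (M : nat) (delta : R) (D : CK K -> vecR M) (Ds : vecR M -> CK K) : Prop :=
  clin_sample D /\ clin_recon Ds /\
  (forall v : vecR M, D (Ds v) = v) /\
  exists c, c < delta /\
    forall f, X f -> forall x, Rabs (ev (Ds (D f)) x - ev f x) <= c.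

Definition affine_map {m n : nat} (T : vecR m -> vecR n) : Prop :=
  forall (t : R) (v w : vecR m) (j : Fin.t n),
    T (fun i => t * v i + (1 - t) * w i) j = t * T v j + (1 - t) * T w j.

Definition poly_eval (l : list R) (x : R) : R :=
  fold_right (fun a acc => a + x * acc) 0 l.

Definition is_polynomial (g : R -> R) : Prop :=
  exists l : list R, forall x, g x = poly_eval l x.

(* Main.v *)
(* Universality of one hidden layer, on a set where all affine functionals are
   bounded: let A be the uniform closure of the span of the neurons g o l, with l
   affine. If q (f o l) lies in A for all affine l, then so does q m (D_h f o l)
   for all affine l, m, where D_h f (x) = f (x + h) - f x: approximate
   q (D_h P o l), with P' = f, by Riemann sums, and differentiate in l in the
   direction m. Hence m_1 ... m_k (D_h1 ... D_hk g)(b) lies in A; since g is not a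
   polynomial, some k-th difference is nonzero, so A contains every product of
   affine functionals, and with it a closed algebra that is stable under |.| and
   under inversion of functions bounded below.

   Sampling is evaluation at a separated net of K, and reconstruction uses a
   partition of unity made of hats around the net; it is a contraction for the sup
   norm. The set on which networks approximate is E itself, the affine functionals
   being those of the samples of f. Since F is uniformly continuous near the
   compact set E, the samples of F f are close to a weighted mean of the samples of
   F u_i, where the u_i form a finite net of E for the sample distance and the
   weights are normalised hats of that distance; these lie in the algebra above. *)
Require Import Defs.
From Coquelicot Require Import Coquelicot.
From Stdlib Require Import Reals.
From Stdlib Require Import Lra Lia List Classical ClassicalEpsilon FunctionalExtensionality.
From Stdlib Require Vectors.Fin.
Import ListNotations.
Open Scope R_scope.

(** * Finite sums, hats and finite nets *)

Fixpoint fsum {n : nat} : (Fin.t n -> R) -> R :=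
  match n with
  | O => fun _ => 0
  | S _ => fun u => u Fin.F1 + fsum (fun i => u (Fin.FS i))
  end.

Lemma fsum_ext n (u v : Fin.t n -> R) : (forall i, u i = v i) -> fsum u = fsum v.
Proof. intros H; f_equal; apply functional_extensionality, H. Qed.

Lemma fsum_plus n (u v : Fin.t n -> R) :
  fsum (fun i => u i + v i) = fsum u + fsum v.
Proof. induction n as [|n IH]; simpl; [|rewrite IH]; lra. Qed.

Lemma fsum_scal n (a : R) (u : Fin.t n -> R) :
  fsum (fun i => a * u i) = a * fsum u.
Proof. induction n as [|n IH]; simpl; [|rewrite IH]; lra. Qed.

Lemma fsum_le n (u v : Fin.t n -> R) : (forall i, u i <= v i) -> fsum u <= fsum v.
Proof.
  induction n as [|n IH]; intros H; simpl; [lra|].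
  apply Rplus_le_compat; [apply H | apply IH; intros i; apply H].
Qed.

Lemma fsum_const n (c : R) : fsum (fun _ : Fin.t n => c) = INR n * c.
Proof.
  induction n as [|n IH]; [simpl; lra|].
  rewrite S_INR; simpl; rewrite IH; lra.
Qed.

Lemma fsum_nonneg n (u : Fin.t n -> R) : (forall i, 0 <= u i) -> 0 <= fsum u.
Proof.
  intros H; apply Rle_trans with (fsum (fun _ : Fin.t n => 0)).
  - rewrite fsum_const; lra.
  - apply fsum_le, H.
Qed.

Lemma fsum_ge_term n (u : Fin.t n -> R) i : (forall i, 0 <= u i) -> u i <= fsum u.
Proof.
  induction i as [n|n i IH]; intros H; simpl.
  - assert (0 <= fsum (fun i => u (Fin.FS i))) by (apply fsum_nonneg; intros; apply H).
    lra.
  - specialize (IH (fun i => u (Fin.FS i)) (fun i => H _)); simpl in IH.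
    specialize (H Fin.F1); lra.
Qed.

Lemma fsum_single n (u : Fin.t n -> R) i : (forall j, j <> i -> u j = 0) -> fsum u = u i.
Proof.
  induction i as [n|n i IH]; intros H; simpl.
  - rewrite (fsum_ext _ _ (fun _ => 0)), fsum_const; [lra|].
    intros j; apply H; discriminate.
  - rewrite (IH (fun i => u (Fin.FS i))), H; [lra|discriminate|].
    intros j Hj; apply H; intros E; apply Fin.FS_inj in E; auto.
Qed.

Lemma fsum_Rabs n (u : Fin.t n -> R) : Rabs (fsum u) <= fsum (fun i => Rabs (u i)).
Proof.
  induction n as [|n IH]; simpl; [rewrite Rabs_R0; lra|].
  eapply Rle_trans; [apply Rabs_triang|].
  specialize (IH (fun i => u (Fin.FS i))); lra.
Qed.

(** The normalised weights sum to 1, so [b] moves inside the mean, and only values of positive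
    weight matter. This gives the sampling error, the contractivity of the reconstruction and the
    accuracy of the interpolant of [F]. *)
Lemma weighted_mean_close n (w a : Fin.t n -> R) (b c : R) :
  (forall i, 0 <= w i) -> 0 < fsum w -> (forall i, 0 < w i -> Rabs (a i - b) <= c) ->
  Rabs (fsum (fun i => a i * (w i / fsum w)) - b) <= c.
Proof.
  intros Hw Hs Ha.
  replace (fsum (fun i => a i * (w i / fsum w)) - b)
    with (/ fsum w * fsum (fun i => (a i - b) * w i)).
  2:{ rewrite (fsum_ext _ (fun i => (a i - b) * w i)
        (fun i => fsum w * (a i * (w i / fsum w)) + - b * w i)).
      - rewrite fsum_plus, 2!fsum_scal; field; lra.
      - intros i; field; lra. }
  rewrite Rabs_mult, Rabs_inv, (Rabs_pos_eq (fsum w)) by lra.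
  apply Rmult_le_reg_l with (fsum w); [assumption|].
  rewrite <- Rmult_assoc, Rinv_r, Rmult_1_l by lra.
  eapply Rle_trans; [apply fsum_Rabs|].
  rewrite Rmult_comm, <- fsum_scal; apply fsum_le; intros i.
  rewrite Rabs_mult, (Rabs_pos_eq (w i)) by apply Hw.
  destruct (Hw i) as [H|<-]; [|lra].
  apply Rmult_le_compat_r; [lra | auto].
Qed.

(** * Hats and the l1 distance *)

Definition hat (r t : R) : R := Rmax 0 (r - t).

Lemma hat_nonneg r t : 0 <= hat r t.
Proof. apply Rmax_l. Qed.

Lemma hat_pos r t : 0 < hat r t -> t < r.
Proof. unfold hat, Rmax; destruct Rle_dec; lra. Qed.

Lemma hat_lower r t : r - t <= hat r t.
Proof. apply Rmax_r. Qed.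

Lemma hat_zero r t : r <= t -> hat r t = 0.
Proof. unfold hat, Rmax; destruct Rle_dec; lra. Qed.

Lemma hat_lipschitz r t t' : Rabs (hat r t - hat r t') <= Rabs (t - t').
Proof. unfold hat, Rmax, Rabs; repeat destruct Rle_dec; repeat destruct Rcase_abs; lra. Qed.

(** The l1 distance is chosen because sums and absolute values preserve the closed algebra of
    functions of the samples. *)
Definition dist1 {n : nat} (u v : Fin.t n -> R) : R := fsum (fun i => Rabs (u i - v i)).

Lemma dist1_sym n (u v : Fin.t n -> R) : dist1 u v = dist1 v u.
Proof. apply fsum_ext; intros; apply Rabs_minus_sym. Qed.

Lemma dist1_coord n (u v : Fin.t n -> R) i : Rabs (u i - v i) <= dist1 u v.
Proof.
  apply (fsum_ge_term _ (fun i => Rabs (u i - v i))); intros; apply Rabs_pos.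
Qed.

Lemma dist1_triang n (u v w : Fin.t n -> R) : dist1 u w <= dist1 u v + dist1 v w.
Proof.
  unfold dist1; rewrite <- fsum_plus; apply fsum_le; intros i.
  replace (u i - w i) with ((u i - v i) + (v i - w i)) by lra; apply Rabs_triang.
Qed.

Lemma dist1_le n (u v : Fin.t n -> R) c :
  (forall i, Rabs (u i - v i) <= c) -> dist1 u v <= INR n * c.
Proof. intros H; rewrite <- fsum_const; apply fsum_le, H. Qed.

Lemma dist1_lt n r : 0 < r -> exists c, 0 < c /\
  forall u v : Fin.t n -> R, (forall i, Rabs (u i - v i) < c) -> dist1 u v < r.
Proof.
  intros Hr; assert (Hn := pos_INR n).
  (* The added 1 covers [n = 0] and makes the final inequality strict. *)
  assert (Hc : 0 < r / (INR n + 1)) by (apply Rdiv_lt_0_compat; lra).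
  exists (r / (INR n + 1)); split; [assumption|].
  intros u v H.
  apply Rle_lt_trans with (INR n * (r / (INR n + 1))).
  - apply dist1_le; intros i; left; apply H.
  - replace r with ((INR n + 1) * (r / (INR n + 1))) at 2 by (field; lra).
    lra.
Qed.

Lemma dist1_hat_lipschitz n r (p x y : Fin.t n -> R) :
  Rabs (hat r (dist1 y p) - hat r (dist1 x p)) <= dist1 y x.
Proof.
  eapply Rle_trans; [apply hat_lipschitz|].
  assert (H1 := dist1_triang _ y x p); assert (H2 := dist1_triang _ x y p).
  rewrite (dist1_sym _ x y) in H2; apply Rabs_le; lra.
Qed.

(** * Finite separated nets *)

Fixpoint fnth {X : Type} (l : list X) : Fin.t (length l) -> X :=
  match l with
  | [] => fun i => Fin.case0 (fun _ => X) i
  | a :: l => fun i => Fin.caseS' i (fun _ => X) a (fnth l)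
  end.

Lemma fnth_In X (l : list X) i : In (fnth l i) l.
Proof.
  induction l as [|a l IH]; [inversion i|].
  apply (Fin.caseS' i); [left; reflexivity | intros j; right; apply IH].
Qed.

Lemma In_fnth X (l : list X) x : In x l -> exists i, fnth l i = x.
Proof.
  induction l as [|a l IH]; [intros []|].
  intros [<-|H]; [exists Fin.F1; reflexivity|].
  destruct (IH H) as [i Hi]; exists (Fin.FS i); exact Hi.
Qed.

Lemma fnth_pairwise X (R : X -> X -> Prop) (l : list X) :
  (forall x y, R x y -> R y x) -> ForallOrdPairs R l ->
  forall i j, i <> j -> R (fnth l i) (fnth l j).
Proof.
  intros Hsym; induction 1 as [|a l Ha _ IH]; intros i j; [inversion i|].
  rewrite Forall_forall in Ha.
  apply (Fin.caseS' i); [|intros i']; apply (Fin.caseS' j); [|intros j'| |intros j']; intros Hij.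
  - congruence.
  - apply (Ha (fnth l j')), fnth_In.
  - apply Hsym, (Ha (fnth l i')), fnth_In.
  - apply (IH i' j'); congruence.
Qed.

(** A separated list that cannot be extended is a net. If every separated list could be extended,
    choice would build an infinite sequence without near pairs. The relation [near] stays abstract
    so as to serve for points of [K] and for functions in [E]. *)
Lemma finite_separated_net X (Y : X -> Prop) (near : X -> X -> Prop) :
  (forall x y, near x y -> near y x) ->
  (forall s : nat -> X, (forall n, Y (s n)) -> exists p q, (p < q)%nat /\ near (s q) (s p)) ->
  exists (n : nat) (u : Fin.t n -> X),
    (forall i, Y (u i)) /\ (forall i j, i <> j -> ~ near (u i) (u j)) /\
    forall x, Y x -> exists i, near x (u i).
Proof.
  intros Hsym Hseq.
  set (far := fun l x => Y x /\ Forall (fun y => ~ near x y) l).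
  destruct (classic (exists l, Forall Y l /\ ForallOrdPairs (fun x y => ~ near x y) l /\
    forall x, ~ far l x)) as [(l & HY & Hsep & Hmax)|Hno].
  - exists (length l), (fnth l); split; [|split].
    + intros i; rewrite Forall_forall in HY; apply HY, fnth_In.
    + apply (fnth_pairwise _ (fun x y => ~ near x y)); auto.
    + intros x Hx; apply NNPP; intros Hn; apply (Hmax x); split; [assumption|].
      apply Forall_forall; intros y Hy Hxy.
      destruct (In_fnth _ _ _ Hy) as [i <-]; eauto.
  (* The implication sits under the existential so that [next] is total. If nothing extends [l], any
     point of [Y] is a witness, and an empty [Y] would make [[]] maximal. *)
  - assert (Hext : forall l, exists x,
      Forall Y l /\ ForallOrdPairs (fun x y => ~ near x y) l -> far l x).
    { intros l; destruct (classic (exists x, far l x)) as [[x Hx]|H]; [exists x; auto|].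
      destruct (classic (exists x, Y x)) as [[x0 _]|HY].
      - exists x0; intros [H1 H2]; exfalso; apply Hno; exists l; repeat split; auto.
        intros x Hx; eauto.
      - exfalso; apply Hno; exists []; repeat split; try constructor.
        intros x [Hx _]; eauto. }
    set (next := fun l => proj1_sig (constructive_indefinite_description _ (Hext l))).
    assert (Hnext : forall l, Forall Y l /\ ForallOrdPairs (fun x y => ~ near x y) l ->
      far l (next l)).
    { intros l; unfold next; destruct constructive_indefinite_description; auto. }
    (* [pre n] holds the first [n] chosen points, the latest at the head. *)
    set (pre := nat_rect (fun _ => list X) [] (fun _ l => next l :: l)).
    assert (Hpre : forall n, Forall Y (pre n) /\
      ForallOrdPairs (fun x y => ~ near x y) (pre n)).
    { induction n as [|n IH]; [split; constructor|].
      destruct (Hnext _ IH); destruct IH; split; simpl; constructor; auto. }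
    assert (Hin : forall p q, (p < q)%nat -> In (next (pre p)) (pre q)).
    { induction 1; simpl; auto. }
    destruct (Hseq (fun n => next (pre n))) as (p & q & Hpq & Hnear).
    + intros n; apply Hnext, Hpre.
    + exfalso; destruct (Hnext _ (Hpre q)) as [_ Hf]; rewrite Forall_forall in Hf.
      exact (Hf _ (Hin _ _ Hpq) Hnear).
Qed.

Lemma strictly_increasing_ge (phi : nat -> nat) :
  (forall n, (phi n < phi (S n))%nat) -> forall n, (n <= phi n)%nat.
Proof. intros H; induction n as [|n IH]; [lia | specialize (H n); lia]. Qed.

Lemma inv_INR_S_small eps : 0 < eps -> exists N, forall n, (N <= n)%nat -> / INR (S n) < eps.
Proof.
  intros He; destruct (archimed_cor1 eps He) as (N & HN & HN0).
  exists N; intros n Hn; eapply Rle_lt_trans; [|exact HN].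
  apply Rinv_le_contravar; [apply lt_0_INR; lia | apply le_INR; lia].
Qed.

(** * Functions with vanishing finite differences *)

Lemma continuous_primitive (f : R -> R) :
  continuity f -> exists P, forall x, is_derive P x (f x).
Proof.
  intros Hf.
  assert (Hc : forall x, continuous f x) by (intros x; apply continuity_pt_filterlim, Hf).
  exists (fun x => RInt f 0 x); intros x.
  apply (is_derive_RInt f (fun x => RInt f 0 x) 0 x); [|apply Hc].
  apply filter_forall; intros y.
  apply (RInt_correct (V := R_CompleteNormedModule)), ex_RInt_continuous.
  intros; apply Hc.
Qed.

Lemma mean_value (f df : R -> R) (a b : R) :
  (forall x, is_derive f x (df x)) ->
  exists c, Rmin a b <= c <= Rmax a b /\ f b - f a = df c * (b - a).
Proof.
  intros H; apply MVT_gen; intros x _; [apply H|].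
  apply continuity_pt_filterlim, (ex_derive_continuous f); exists (df x); apply H.
Qed.

(** * Polynomials as coefficient lists *)

Fixpoint poly_add (l m : list R) : list R :=
  match l, m with
  | [], _ => m
  | _, [] => l
  | a :: l, b :: m => (a + b) :: poly_add l m
  end.

Lemma poly_eval_cons a l x : poly_eval (a :: l) x = a + x * poly_eval l x.
Proof. reflexivity. Qed.

Lemma poly_eval_add l m x : poly_eval (poly_add l m) x = poly_eval l x + poly_eval m x.
Proof.
  revert m; induction l as [|a l IH]; intros [|b m].
  1-3: simpl; lra.
  simpl poly_add; rewrite 3!poly_eval_cons, IH; lra.
Qed.

Lemma poly_eval_scal c l x : poly_eval (map (Rmult c) l) x = c * poly_eval l x.
Proof.
  induction l as [|a l IH]; simpl map; [simpl; lra|].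
  rewrite 2!poly_eval_cons, IH; lra.
Qed.

Lemma is_polynomial_const c : is_polynomial (fun _ => c).
Proof. exists [c]; intros x; simpl; lra. Qed.

Lemma is_polynomial_mulX f : is_polynomial f -> is_polynomial (fun x => x * f x).
Proof. intros [l Hl]; exists (0 :: l); intros x; rewrite Hl, poly_eval_cons; lra. Qed.

Lemma is_polynomial_plus f g :
  is_polynomial f -> is_polynomial g -> is_polynomial (fun x => f x + g x).
Proof.
  intros [l Hl] [m Hm]; exists (poly_add l m); intros x.
  rewrite poly_eval_add, Hl, Hm; reflexivity.
Qed.

Lemma is_polynomial_scal c f : is_polynomial f -> is_polynomial (fun x => c * f x).
Proof.
  intros [l Hl]; exists (map (Rmult c) l); intros x.
  rewrite poly_eval_scal, Hl; reflexivity.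
Qed.

Lemma is_polynomial_pow n : is_polynomial (fun x => x ^ n).
Proof.
  induction n as [|n IH]; [apply (is_polynomial_const 1)|].
  apply is_polynomial_mulX in IH; exact IH.
Qed.

Lemma polynomial_derivative f :
  is_polynomial f -> exists df, is_polynomial df /\ forall x, is_derive f x (df x).
Proof.
  intros [l Hl].
  apply functional_extensionality in Hl; subst f.
  induction l as [|a l (dp & Hp & Hd)].
  - exists (fun _ => 0); split; [apply is_polynomial_const|].
    intros x; apply (is_derive_const (V := R_NormedModule) 0 x).
  - exists (fun x => poly_eval l x + x * dp x); split.
    + apply is_polynomial_plus; [exists l; reflexivity | apply is_polynomial_mulX, Hp].
    + intros x; simpl; fold (poly_eval l).
      evar_last.
      * apply (is_derive_plus (V := R_NormedModule) (fun _ => a) (fun x => x * poly_eval l x)).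
        -- apply is_derive_const.
        -- apply (is_derive_mult (fun x => x) (poly_eval l)); [apply is_derive_id | apply Hd|].
           intros; apply Rmult_comm.
      * unfold plus, zero, mult, one; simpl; lra.
Qed.

Lemma polynomial_primitive f :
  is_polynomial f -> exists P, is_polynomial P /\ forall x, is_derive P x (f x).
Proof.
  intros [l Hl].
  (* The factor [x ^ n] makes the induction on Horner form work: [x ^ n * (a + x * p)] splits into a
     monomial and [x ^ S n * p]. *)
  assert (H : forall n, exists P, is_polynomial P /\
    forall x, is_derive P x (x ^ n * poly_eval l x)).
  { clear f Hl; induction l as [|a l IH]; intros n.
    - exists (fun _ => 0); split; [apply is_polynomial_const|].
      intros x; simpl; rewrite Rmult_0_r; apply (is_derive_const (V := R_NormedModule) 0 x).
    - destruct (IH (S n)) as (P & HP & Hd).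
      exists (fun x => a / INR (S n) * x ^ S n + P x); split.
      + apply is_polynomial_plus; [apply is_polynomial_scal, is_polynomial_pow | exact HP].
      + intros x; evar_last.
        * apply (is_derive_plus (V := R_NormedModule)
            (fun x => a / INR (S n) * x ^ S n) P); [|apply Hd].
          apply (is_derive_scal (fun x => x ^ S n)), is_derive_Reals, derivable_pt_lim_pow.
        * assert (INR (S n) <> 0) by (apply not_0_INR; lia).
          change (poly_eval (a :: l) x) with (a + x * poly_eval l x).
          unfold plus; simpl pred; simpl AbelianMonoid.plus.
          simpl pow.
          field_simplify; [reflexivity|assumption]. }
  destruct (H O) as (P & HP & Hd); exists P; split; [exact HP|].
  intros x; rewrite Hl; specialize (Hd x); simpl in Hd; rewrite Rmult_1_l in Hd; exact Hd.
Qed.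

(** * Iterated finite differences *)

Definition fdiff (h : R) (f : R -> R) : R -> R := fun x => f (x + h) - f x.

Fixpoint fdiffs (hs : list R) (f : R -> R) : R -> R :=
  match hs with
  | [] => f
  | h :: hs => fdiff h (fdiffs hs f)
  end.

Lemma fdiffs_fdiff hs h f : fdiffs hs (fdiff h f) = fdiff h (fdiffs hs f).
Proof.
  induction hs as [|t hs IH]; simpl; [reflexivity|].
  rewrite IH; unfold fdiff; apply functional_extensionality; intros x.
  replace (x + h + t) with (x + t + h) by lra; lra.
Qed.

Lemma fdiffs_minus hs f g :
  fdiffs hs (fun x => f x - g x) = fun x => fdiffs hs f x - fdiffs hs g x.
Proof.
  induction hs as [|t hs IH]; simpl; [reflexivity|].
  rewrite IH; unfold fdiff; apply functional_extensionality; intros x; lra.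
Qed.

Lemma fdiff_continuity h f : continuity f -> continuity (fdiff h f).
Proof.
  intros Hf; apply (continuity_minus (fun x => f (x + h)) f); [|exact Hf].
  apply (continuity_comp (fun x => x + h) f); [|exact Hf].
  apply derivable_continuous; reg.
Qed.

Lemma fdiffs_continuity hs f : continuity f -> continuity (fdiffs hs f).
Proof.
  intros Hf; induction hs as [|h hs IH]; [exact Hf | apply fdiff_continuity, IH].
Qed.

Lemma fdiff_derive h f df :
  (forall x, is_derive f x (df x)) -> forall x, is_derive (fdiff h f) x (fdiff h df x).
Proof.
  intros H x; unfold fdiff.
  apply (is_derive_minus (V := R_NormedModule) (fun x => f (x + h)) f); [|apply H].
  evar_last.
  - apply (is_derive_comp (V := R_NormedModule) f (fun x => x + h)); [apply H|].
    auto_derive; auto.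
  - unfold scal; simpl; unfold mult; simpl; lra.
Qed.

Lemma fdiffs_derive hs f df :
  (forall x, is_derive f x (df x)) -> forall x, is_derive (fdiffs hs f) x (fdiffs hs df x).
Proof.
  intros H; induction hs as [|h hs IH]; [exact H | apply fdiff_derive, IH].
Qed.

Lemma derive_eq_diff_const (f g df : R -> R) :
  (forall x, is_derive f x (df x)) -> (forall x, is_derive g x (df x)) ->
  forall x, f x = g x + (f 0 - g 0).
Proof.
  intros Hf Hg x.
  destruct (mean_value (fun x => f x - g x) (fun x => df x - df x) 0 x) as (c & _ & Hc).
  - intros y; apply (is_derive_minus (V := R_NormedModule) f g); auto.
  - lra.
Qed.

(* With [P' = f], the function [r x = P (x + 1) - P x - f x] is killed by one
   difference fewer than [f], so by induction it and [fdiff 1 f] are polynomials;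
   then [f = fdiff 1 P - r] is differentiable with polynomial derivative. *)
Lemma fdiffs_zero_polynomial k : forall f, continuity f ->
  (forall hs, length hs = k -> forall x, fdiffs hs f x = 0) -> is_polynomial f.
Proof.
  induction k as [|k IH]; intros f Hf Hz.
  - exists []; intros x; apply (Hz []); reflexivity.
  - destruct (continuous_primitive f Hf) as [P HP].
    assert (HPc : continuity P).
    { intros x; apply continuity_pt_filterlim, (ex_derive_continuous P).
      exists (f x); apply HP. }
    assert (Hr : is_polynomial (fun x => fdiff 1 P x - f x)).
    { apply IH.
      - apply (continuity_minus (fdiff 1 P) f); [apply fdiff_continuity|]; assumption.
      - intros hs Hl x; rewrite fdiffs_minus, fdiffs_fdiff.
        (* One more difference, with step [y - x], vanishes, so [fdiffs hs f] is constant. By the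
           mean value theorem the unit increment of its primitive [fdiffs hs P] is that same
           constant. *)
        assert (Hc : forall y, fdiffs hs f y = fdiffs hs f x).
        { intros y; specialize (Hz ((y - x) :: hs)); simpl in Hz.
          specialize (Hz (f_equal S Hl) x); unfold fdiff in Hz.
          replace (x + (y - x)) with y in Hz by lra; lra. }
        destruct (mean_value (fdiffs hs P) (fdiffs hs f) x (x + 1)) as (c & _ & He).
        + apply fdiffs_derive, HP.
        + rewrite Hc in He; unfold fdiff; lra. }
    assert (Hd : is_polynomial (fdiff 1 f)).
    { apply IH; [apply fdiff_continuity, Hf|].
      intros hs Hl x; rewrite fdiffs_fdiff; apply (Hz (1 :: hs)); simpl; congruence. }
    destruct (polynomial_derivative _ Hr) as (dr & Hdr & Hr').
    destruct (polynomial_primitive (fun x => fdiff 1 f x + -1 * dr x)) as (Q & HQ & HQ').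
    { apply is_polynomial_plus; [|apply is_polynomial_scal]; assumption. }
    assert (Hf' : forall x, is_derive f x (fdiff 1 f x + -1 * dr x)).
    { intros x; apply (is_derive_ext (fun x => fdiff 1 P x - (fdiff 1 P x - f x)));
        [intros t; lra|].
      evar_last.
      - apply (is_derive_minus (V := R_NormedModule) (fdiff 1 P)); [|apply Hr'].
        apply fdiff_derive, HP.
      - unfold minus, plus, opp; simpl; lra. }
    assert (Hp := is_polynomial_plus Q _ HQ (is_polynomial_const (f 0 - Q 0))).
    destruct Hp as [l Hl]; exists l; intros x; rewrite <- Hl.
    exact (derive_eq_diff_const _ _ _ Hf' HQ' x).
Qed.

(** Every order [k] is covered, because the order is dictated by the number of affine factors to be
    produced. *)
Lemma nonpolynomial_fdiffs_nonzero g : continuity g -> ~ is_polynomial g ->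
  forall k, exists hs b, length hs = k /\ fdiffs hs g b <> 0.
Proof.
  intros Hg Hn k; apply NNPP; intros H; apply Hn, (fdiffs_zero_polynomial k); [exact Hg|].
  intros hs Hl x; apply NNPP; intros Hx; apply H; eauto.
Qed.

(** * Uniformly closed spans *)

(** Linear combinations are built one term at a time, so that the neurons of a network can be read
    off by induction. *)
Inductive span {X : Type} (S : (X -> R) -> Prop) : (X -> R) -> Prop :=
| span_zero : span S (fun _ => 0)
| span_cons c s h : S s -> span S h -> span S (fun x => c * s x + h x).

Definition close_on {X : Type} (Y : X -> Prop) (e : R) (f h : X -> R) : Prop :=
  forall x, Y x -> Rabs (h x - f x) <= e.

Definition cl_span {X : Type} (Y : X -> Prop) (S : (X -> R) -> Prop) (f : X -> R) : Prop :=
  forall e, 0 < e -> exists h, span S h /\ close_on Y e f h.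

Definition bounded_on {X : Type} (Y : X -> Prop) (f : X -> R) : Prop :=
  exists C, 0 < C /\ forall x, Y x -> Rabs (f x) <= C.

Lemma bounded_on_const X (Y : X -> Prop) c : bounded_on Y (fun _ => c).
Proof. exists (Rabs c + 1); assert (H := Rabs_pos c); split; [lra | intros; lra]. Qed.

Lemma bounded_on_plus X (Y : X -> Prop) f g :
  bounded_on Y f -> bounded_on Y g -> bounded_on Y (fun x => f x + g x).
Proof.
  intros (C & HC & Hf) (D & HD & Hg); exists (C + D); split; [lra|].
  intros x Hx; eapply Rle_trans; [apply Rabs_triang|].
  specialize (Hf x Hx); specialize (Hg x Hx); lra.
Qed.

Lemma bounded_on_mult X (Y : X -> Prop) f g :
  bounded_on Y f -> bounded_on Y g -> bounded_on Y (fun x => f x * g x).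
Proof.
  intros (C & HC & Hf) (D & HD & Hg); exists (C * D); split; [nra|].
  intros x Hx; rewrite Rabs_mult.
  apply Rmult_le_compat; auto using Rabs_pos.
Qed.

Lemma bounded_on_fsum X (Y : X -> Prop) n (u : Fin.t n -> X -> R) :
  (forall i, bounded_on Y (u i)) -> bounded_on Y (fun x => fsum (fun i => u i x)).
Proof.
  induction n as [|n IH]; intros H; simpl; [apply bounded_on_const|].
  apply bounded_on_plus; [apply H | apply (IH (fun i => u (Fin.FS i))); intros; apply H].
Qed.

Lemma bounded_on_span X (Y : X -> Prop) S f :
  (forall s, S s -> bounded_on Y s) -> span S f -> bounded_on Y f.
Proof.
  intros HS; induction 1 as [|c s h Hs _ IH]; [apply bounded_on_const|].
  apply bounded_on_plus; [|exact IH].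
  apply bounded_on_mult; [apply bounded_on_const | auto].
Qed.

Lemma bounded_on_cl_span X (Y : X -> Prop) S f :
  (forall s, S s -> bounded_on Y s) -> cl_span Y S f -> bounded_on Y f.
Proof.
  intros HS Hf; destruct (Hf 1) as (h & Hh & Hfh); [lra|].
  destruct (bounded_on_span _ _ _ _ HS Hh) as (C & HC & Hb).
  exists (C + 1); split; [lra|]; intros x Hx.
  specialize (Hb x Hx); specialize (Hfh x Hx).
  replace (f x) with (h x - (h x - f x)) by lra.
  eapply Rle_trans; [apply Rabs_triang|]; rewrite Rabs_Ropp; lra.
Qed.

Lemma span_plus X (S : (X -> R) -> Prop) f g :
  span S f -> span S g -> span S (fun x => f x + g x).
Proof.
  intros Hf Hg; induction Hf as [|c s h Hs _ IH].
  - replace (fun x => 0 + g x) with g; [exact Hg|].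
    apply functional_extensionality; intros; lra.
  - replace (fun x => c * s x + h x + g x) with (fun x => c * s x + (h x + g x)).
    + constructor; assumption.
    + apply functional_extensionality; intros; lra.
Qed.

Lemma span_scal X (S : (X -> R) -> Prop) a f : span S f -> span S (fun x => a * f x).
Proof.
  induction 1 as [|c s h Hs _ IH].
  - replace (fun _ : X => a * 0) with (fun _ : X => 0); [constructor|].
    apply functional_extensionality; intros; lra.
  - replace (fun x => a * (c * s x + h x)) with (fun x => (a * c) * s x + a * h x).
    + constructor; assumption.
    + apply functional_extensionality; intros; lra.
Qed.

Lemma span_incl X (S : (X -> R) -> Prop) s : S s -> span S s.
Proof.
  intros Hs; replace s with (fun x => 1 * s x + 0).
  - repeat constructor; assumption.
  - apply functional_extensionality; intros; lra.
Qed.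

Lemma span_mult X (S : (X -> R) -> Prop) f g :
  (forall s t, S s -> S t -> S (fun x => s x * t x)) ->
  span S f -> span S g -> span S (fun x => f x * g x).
Proof.
  intros HS Hf Hg; induction Hf as [|c s h Hs _ IH].
  - replace (fun x => 0 * g x) with (fun _ : X => 0); [constructor|].
    apply functional_extensionality; intros; lra.
  - replace (fun x => (c * s x + h x) * g x) with (fun x => c * (s x * g x) + h x * g x).
    + apply span_plus; [|exact IH]; apply span_scal.
      clear IH; induction Hg as [|d t k Ht _ IH].
      * replace (fun x => s x * 0) with (fun _ : X => 0); [constructor|].
        apply functional_extensionality; intros; lra.
      * replace (fun x => s x * (d * t x + k x)) with (fun x => d * (s x * t x) + s x * k x).
        -- constructor; auto.
        -- apply functional_extensionality; intros; lra.
    + apply functional_extensionality; intros; lra.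
Qed.

(* Newton-like iteration for the square root of [s * s], polynomial in [s]. *)
Fixpoint abs_iter (s : R) (n : nat) : R :=
  match n with
  | O => 0
  | S n => abs_iter s n + (s * s - abs_iter s n * abs_iter s n) / 2
  end.

(** The error [e = Rabs s - u] is multiplied by [1 - (Rabs s + u) / 2], which is at most [1 - e / 2]
    since [u] is nonnegative. As [t * (1 - t / 2)] increases on [0,1], the bound [2 / (n + 2)]
    propagates. *)
Lemma abs_iter_bound s n : Rabs s <= 1 ->
  0 <= abs_iter s n <= Rabs s /\ Rabs s - abs_iter s n <= 2 / INR (n + 2).
Proof.
  intros Hs; induction n as [|n [[IH1 IH2] IH3]].
  - simpl; assert (H := Rabs_pos s); split; [lra|].
    replace (2 / (1 + 1)) with 1 by field; lra.
  - assert (Hss : s * s = Rabs s * Rabs s).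
    { rewrite <- Rabs_mult, Rabs_pos_eq; [reflexivity | apply Rle_0_sqr]. }
    cbn [abs_iter]; rewrite Hss.
    set (a := Rabs s) in *; set (u := abs_iter s n) in *; clearbody a u.
    assert (Hn := pos_INR n).
    rewrite plus_INR in IH3; simpl in IH3.
    rewrite plus_INR, S_INR; simpl; set (m := INR n) in *; clearbody m.
    split; [split; nra|].
    assert (Hq : 2 / (m + (1 + 1)) <= 1).
    { apply Rmult_le_reg_r with (m + (1 + 1)); [lra|]; unfold Rdiv.
      rewrite Rmult_assoc, Rinv_l; lra. }
    set (q := 2 / (m + (1 + 1))) in *.
    apply Rle_trans with (q * (1 - q / 2)).
    + set (e := a - u) in *; assert (e * (1 - (a + u) / 2) <= e * (1 - e / 2)) by
        (unfold e; nra).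
      replace (a - (u + (a * a - u * u) / 2)) with (e * (1 - (a + u) / 2)) by (unfold e; lra).
      nra.
    + unfold q; replace (2 / (m + (1 + 1)) * (1 - 2 / (m + (1 + 1)) / 2))
        with (2 * (m + 1) / ((m + 2) * (m + 2))) by (field; lra).
      apply Rmult_le_reg_r with ((m + 2) * (m + 2) * (m + 1 + (1 + 1))); [nra|].
      field_simplify; nra.
Qed.

(** For nonzero [C], the partial sums of the Neumann series of [/ s] in powers of [1 - s / C]; they
    are polynomials in [s]. *)
Fixpoint inv_iter (C s : R) (n : nat) : R :=
  match n with
  | O => 0
  | S n => inv_iter C s n + / C * (1 - s * inv_iter C s n)
  end.

Lemma inv_iter_residual C s n : C <> 0 -> 1 - s * inv_iter C s n = (1 - s / C) ^ n.
Proof.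
  intros HC; induction n as [|n IH]; simpl; [lra|].
  rewrite <- IH; field; exact HC.
Qed.

(** * Stability of closed spans under limits, products, absolute values and inverses *)

Section ClosedSpan.
Context {X : Type} (Y : X -> Prop) (S : (X -> R) -> Prop).

Lemma cl_span_incl s : S s -> cl_span Y S s.
Proof.
  intros Hs e He; exists s; split; [apply span_incl, Hs|].
  intros x _; rewrite Rminus_diag, Rabs_R0; lra.
Qed.

Lemma cl_span_lim f :
  (forall e, 0 < e -> exists h, cl_span Y S h /\ close_on Y e f h) -> cl_span Y S f.
Proof.
  intros H e He; destruct (H (e / 2)) as (h & Hh & Hfh); [lra|].
  destruct (Hh (e / 2)) as (k & Hk & Hhk); [lra|].
  exists k; split; [exact Hk|]; intros x Hx.
  specialize (Hfh x Hx); specialize (Hhk x Hx).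
  replace (k x - f x) with ((k x - h x) + (h x - f x)) by lra.
  eapply Rle_trans; [apply Rabs_triang | lra].
Qed.

Lemma cl_span_ext_on f g :
  (forall x, Y x -> f x = g x) -> cl_span Y S f -> cl_span Y S g.
Proof.
  intros H Hf; apply cl_span_lim; intros e He; exists f; split; [exact Hf|].
  intros x Hx; rewrite H, Rminus_diag, Rabs_R0 by exact Hx; lra.
Qed.

Lemma cl_span_plus f g :
  cl_span Y S f -> cl_span Y S g -> cl_span Y S (fun x => f x + g x).
Proof.
  intros Hf Hg e He.
  destruct (Hf (e / 2)) as (h & Hh & Hfh); [lra|].
  destruct (Hg (e / 2)) as (k & Hk & Hgk); [lra|].
  exists (fun x => h x + k x); split; [apply span_plus; assumption|].
  intros x Hx; specialize (Hfh x Hx); specialize (Hgk x Hx).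
  replace (h x + k x - (f x + g x)) with ((h x - f x) + (k x - g x)) by lra.
  eapply Rle_trans; [apply Rabs_triang | lra].
Qed.

Lemma cl_span_scal a f : cl_span Y S f -> cl_span Y S (fun x => a * f x).
Proof.
  intros Hf e He; assert (Ha := Rabs_pos a).
  destruct (Hf (e / (Rabs a + 1))) as (h & Hh & Hfh); [apply Rdiv_lt_0_compat; lra|].
  exists (fun x => a * h x); split; [apply span_scal, Hh|].
  intros x Hx; specialize (Hfh x Hx).
  rewrite <- Rmult_minus_distr_l, Rabs_mult.
  apply Rle_trans with ((Rabs a + 1) * (e / (Rabs a + 1))); [|right; field; lra].
  apply Rmult_le_compat; auto using Rabs_pos; lra.
Qed.

Lemma cl_span_zero : cl_span Y S (fun _ => 0).
Proof.
  intros e He; exists (fun _ => 0); split; [constructor|].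
  intros x _; rewrite Rminus_diag, Rabs_R0; lra.
Qed.

Lemma cl_span_minus f g :
  cl_span Y S f -> cl_span Y S g -> cl_span Y S (fun x => f x - g x).
Proof.
  intros Hf Hg; apply (cl_span_ext_on (fun x => f x + -1 * g x)); [intros; lra|].
  apply cl_span_plus; [|apply cl_span_scal]; assumption.
Qed.

Lemma cl_span_fsum n (u : Fin.t n -> X -> R) :
  (forall i, cl_span Y S (u i)) -> cl_span Y S (fun x => fsum (fun i => u i x)).
Proof.
  induction n as [|n IH]; intros H; simpl; [apply cl_span_zero|].
  apply cl_span_plus; [apply H | apply (IH (fun i => u (Fin.FS i))); intros; apply H].
Qed.

Hypothesis HSm : forall s t, S s -> S t -> S (fun x => s x * t x).
Hypothesis HSb : forall s, S s -> bounded_on Y s.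

Lemma cl_span_mult f g :
  cl_span Y S f -> cl_span Y S g -> cl_span Y S (fun x => f x * g x).
Proof.
  intros Hf Hg e He.
  destruct (bounded_on_cl_span _ _ _ _ HSb Hg) as (C & HC & Hb).
  destruct (Hf (e / (2 * C))) as (h & Hh & Hfh); [apply Rdiv_lt_0_compat; lra|].
  destruct (bounded_on_span _ _ _ _ HSb Hh) as (D & HD & Hd).
  (* The error splits as [(h - f) * g + h * (k - g)]; [D] bounds the approximant [h], so [k] is
     chosen after it. *)
  destruct (Hg (e / (2 * D))) as (k & Hk & Hgk); [apply Rdiv_lt_0_compat; lra|].
  exists (fun x => h x * k x); split; [apply span_mult; assumption|].
  intros x Hx; specialize (Hfh x Hx); specialize (Hgk x Hx);
    specialize (Hb x Hx); specialize (Hd x Hx).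
  replace (h x * k x - f x * g x) with ((h x - f x) * g x + h x * (k x - g x)) by lra.
  eapply Rle_trans; [apply Rabs_triang|]; rewrite 2!Rabs_mult.
  apply Rle_trans with (e / (2 * C) * C + D * (e / (2 * D))); [|right; field; lra].
  apply Rplus_le_compat; apply Rmult_le_compat; auto using Rabs_pos.
Qed.

Lemma cl_span_abs f : cl_span Y S f -> cl_span Y S (fun x => Rabs (f x)).
Proof.
  intros Hf; destruct (bounded_on_cl_span _ _ _ _ HSb Hf) as (C & HC & Hb).
  apply cl_span_lim; intros e He.
  destruct (inv_INR_S_small (e / (2 * C))) as [N HN]; [apply Rdiv_lt_0_compat; lra|].
  (* Dividing by the bound [C] brings the values of [f] on [Y] into [-1,1], where [abs_iter]
     converges uniformly. *)
  exists (fun x => C * abs_iter (/ C * f x) N); split.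
  - apply cl_span_scal; clear HN; induction N as [|N IH]; simpl; [apply cl_span_zero|].
    apply cl_span_plus; [exact IH|].
    apply (cl_span_ext_on (fun x => / 2 * (/ C * f x * (/ C * f x)
      - abs_iter (/ C * f x) N * abs_iter (/ C * f x) N))); [intros; lra|].
    apply cl_span_scal, cl_span_minus; apply cl_span_mult; try apply cl_span_scal; assumption.
  - intros x Hx; specialize (Hb x Hx).
    assert (Hs : Rabs (/ C * f x) = / C * Rabs (f x)).
    { rewrite Rabs_mult, Rabs_pos_eq; [reflexivity | left; apply Rinv_0_lt_compat, HC]. }
    destruct (abs_iter_bound (/ C * f x) N) as [[H1 H2] H3].
    { rewrite Hs; apply Rmult_le_reg_l with C; [exact HC|].
      rewrite <- Rmult_assoc, Rinv_r; lra. }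
    set (u := abs_iter (/ C * f x) N) in *; rewrite Hs in H2, H3.
    replace (Rabs (f x)) with (C * (/ C * Rabs (f x))) by (field; lra).
    set (a := / C * Rabs (f x)) in *.
    rewrite Rabs_minus_sym, Rabs_pos_eq by nra.
    specialize (HN N (Nat.le_refl N)).
    assert (2 / INR (N + 2) <= 2 * / INR (Datatypes.S N)).
    { apply Rmult_le_compat_l; [lra|].
      apply Rinv_le_contravar; [apply lt_0_INR; lia | apply le_INR; lia]. }
    replace e with (C * (2 * (e / (2 * C)))) by (field; lra).
    nra.
Qed.

Hypothesis HS1 : S (fun _ => 1).

Lemma cl_span_inv f c : 0 < c -> (forall x, Y x -> c <= f x) ->
  cl_span Y S f -> cl_span Y S (fun x => / f x).
Proof.
  intros Hc Hcf Hf; destruct (bounded_on_cl_span _ _ _ _ HSb Hf) as (C0 & HC0 & Hb0).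
  (* With this [C] the quotient [f x / C] stays between [c / C] and 1, so the residuals decay
     uniformly like powers of [1 - c / C]. *)
  set (C := C0 + c); assert (HC : c < C) by (unfold C; lra).
  assert (Hb : forall x, Y x -> f x <= C).
  { intros x Hx; specialize (Hb0 x Hx); assert (H := Rle_abs (f x)); unfold C; lra. }
  assert (Hq : 0 < c / C) by (apply Rdiv_lt_0_compat; lra).
  assert (Hq1 : c / C < 1).
  { apply Rmult_lt_reg_r with C; [lra|]; unfold Rdiv; rewrite Rmult_assoc, Rinv_l; lra. }
  apply cl_span_lim; intros e He.
  (* The factor [c] pays for dividing the residual by [f x], which is at least [c]. *)
  destruct (pow_lt_1_zero (1 - c / C)) with (y := e * c) as [N HN].
  { rewrite Rabs_pos_eq; lra. }
  { nra. }
  exists (fun x => inv_iter C (f x) N); split.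
  - clear HN; induction N as [|N IH]; simpl; [apply cl_span_zero|].
    apply cl_span_plus; [exact IH|]; apply cl_span_scal, cl_span_minus.
    + apply cl_span_incl, HS1.
    + apply cl_span_mult; assumption.
  - intros x Hx; specialize (Hcf x Hx); specialize (Hb x Hx).
    specialize (HN N (Nat.le_refl N)).
    assert (Hr := inv_iter_residual C (f x) N ltac:(lra)).
    replace (inv_iter C (f x) N - / f x) with (- (/ f x * (1 - f x * inv_iter C (f x) N)))
      by (field; lra).
    rewrite Hr, Rabs_Ropp, Rabs_mult, (Rabs_pos_eq (/ f x))
      by (left; apply Rinv_0_lt_compat; lra).
    assert (Hp : Rabs ((1 - f x / C) ^ N) <= e * c).
    { eapply Rle_trans; [|left; exact HN]; rewrite <- 2!RPow_abs.
      assert (c / C <= f x / C)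
        by (apply Rmult_le_compat_r; [left; apply Rinv_0_lt_compat|]; lra).
      assert (f x / C <= 1).
      { apply Rmult_le_reg_r with C; [lra|]; unfold Rdiv; rewrite Rmult_assoc, Rinv_l; lra. }
      apply pow_incr; split; [apply Rabs_pos|]; rewrite 2!Rabs_pos_eq; lra. }
    apply Rmult_le_reg_l with (f x); [lra|].
    rewrite <- Rmult_assoc, Rinv_r, Rmult_1_l by lra.
    nra.
Qed.

Lemma cl_span_hat r f : cl_span Y S f -> cl_span Y S (fun x => hat r (f x)).
Proof.
  intros Hf.
  assert (Hrf : cl_span Y S (fun x => r - f x)).
  { apply cl_span_minus; [|exact Hf].
    apply (cl_span_ext_on (fun x => r * 1)); [intros; lra|].
    apply cl_span_scal, cl_span_incl, HS1. }
  apply (cl_span_ext_on (fun x => / 2 * ((r - f x) + Rabs (r - f x)))).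
  - intros x _; unfold hat, Rmax, Rabs; destruct Rle_dec, Rcase_abs; lra.
  - apply cl_span_scal, cl_span_plus; [|apply cl_span_abs]; exact Hrf.
Qed.
End ClosedSpan.

Lemma cl_span_trans X (Y : X -> Prop) (S S' : (X -> R) -> Prop) f :
  (forall s, S s -> cl_span Y S' s) -> cl_span Y S f -> cl_span Y S' f.
Proof.
  intros HS Hf; apply cl_span_lim; intros e He.
  destruct (Hf e He) as (h & Hh & Hfh); exists h; split; [|exact Hfh].
  clear Hfh; induction Hh as [|c s h Hs _ IH]; [apply cl_span_zero|].
  apply cl_span_plus; [apply cl_span_scal|]; auto.
Qed.

(** * Closed span of the neurons *)

(** The mean value theorem gives the increment as [t * f c], and uniform continuity of [f] on
    [-C, C] compares [f c] with [f a]. The error is relative to [t], so it can be summed over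
    Riemann steps or divided by [t]. *)
Lemma uniform_derivative (P f : R -> R) (C eta : R) :
  (forall x, is_derive P x (f x)) -> continuity f -> 0 < eta ->
  exists del, 0 < del /\ forall a t, Rabs a <= C -> Rabs (a + t) <= C -> Rabs t <= del ->
    Rabs (P (a + t) - P a - t * f a) <= eta * Rabs t.
Proof.
  intros HP Hf He.
  destruct (Heine f _ (compact_P3 (- C) C) (fun x _ => Hf x) (mkposreal _ He)) as [del Hdel].
  (* Halving turns the weak bound on [t] into the strict one of Heine's theorem. *)
  assert (H0 := cond_pos del); exists (del / 2); split; [lra|]; intros a t Ha Hat Ht.
  destruct (mean_value P f a (a + t) HP) as (c & Hc & Heq).
  rewrite Heq; replace (f c * (a + t - a) - t * f a) with ((f c - f a) * t) by lra.
  rewrite Rabs_mult; apply Rmult_le_compat_r; [apply Rabs_pos|].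
  apply Rabs_le_between in Ha, Hat, Ht.
  left; apply Hdel; [| lra |].
  - unfold Rmin, Rmax in Hc; destruct Rle_dec; lra.
  - apply Rabs_lt_between; unfold Rmin, Rmax in Hc; destruct Rle_dec; lra.
Qed.

Fixpoint riemann (f : R -> R) (tau y : R) (n : nat) : R :=
  match n with
  | O => 0
  | S n => riemann f tau y n + tau * f (y + INR n * tau)
  end.

(** The increment of [P] telescopes over the nodes and each step costs [eta * Rabs tau]. The bound
    on [y] keeps all nodes in [-C, C]; [tau] may be negative. *)
Lemma riemann_primitive (P f : R -> R) (C eta del tau y : R) (N : nat) :
  (forall a t, Rabs a <= C -> Rabs (a + t) <= C -> Rabs t <= del ->
    Rabs (P (a + t) - P a - t * f a) <= eta * Rabs t) ->
  Rabs y + INR N * Rabs tau <= C -> Rabs tau <= del ->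
  Rabs (riemann f tau y N - (P (y + INR N * tau) - P y)) <= INR N * (eta * Rabs tau).
Proof.
  intros HP HC Ht.
  assert (Hin : forall n, (n <= N)%nat -> Rabs (y + INR n * tau) <= C).
  { intros n Hn; eapply Rle_trans; [apply Rabs_triang|].
    rewrite Rabs_mult, (Rabs_pos_eq (INR n)) by apply pos_INR.
    apply le_INR in Hn; assert (H := Rabs_pos tau); nra. }
  assert (H : forall n, (n <= N)%nat ->
    Rabs (riemann f tau y n - (P (y + INR n * tau) - P y)) <= INR n * (eta * Rabs tau)).
  { induction n as [|n IH]; intros Hn.
    - simpl; rewrite Rmult_0_l, Rplus_0_r, Rminus_diag, Rminus_diag, Rabs_R0; lra.
    - cbn [riemann]; specialize (IH ltac:(lia)).
      assert (Hn' := Hin _ Hn); assert (Hn0 := Hin n ltac:(lia)).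
      rewrite S_INR in *; replace (y + (INR n + 1) * tau) with (y + INR n * tau + tau) in * by lra.
      specialize (HP _ _ Hn0 Hn' Ht).
      replace (riemann f tau y n + tau * f (y + INR n * tau)
          - (P (y + INR n * tau + tau) - P y))
        with ((riemann f tau y n - (P (y + INR n * tau) - P y))
          - (P (y + INR n * tau + tau) - P (y + INR n * tau) - tau * f (y + INR n * tau)))
        by lra.
      eapply Rle_trans; [apply Rabs_triang|]; rewrite Rabs_Ropp; lra. }
  apply H; lia.
Qed.

(** Monomials in the affine functionals: stable under products, so that their closed span is an
    algebra. *)
Inductive prods {X : Type} (Aff : (X -> R) -> Prop) : (X -> R) -> Prop :=
| prods_one : prods Aff (fun _ => 1)
| prods_cons l p : Aff l -> prods Aff p -> prods Aff (fun x => p x * l x).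

Lemma prods_incl X (Aff : (X -> R) -> Prop) l : Aff l -> prods Aff l.
Proof.
  intros Hl; replace l with (fun x => 1 * l x).
  - apply (prods_cons _ l (fun _ => 1)); [exact Hl | constructor].
  - apply functional_extensionality; intros; lra.
Qed.

Lemma prods_mult X (Aff : (X -> R) -> Prop) p q :
  prods Aff p -> prods Aff q -> prods Aff (fun x => p x * q x).
Proof.
  intros Hp Hq; induction Hq as [|l q Hl _ IH].
  - replace (fun x => p x * 1) with p; [exact Hp|].
    apply functional_extensionality; intros; lra.
  - replace (fun x => p x * (q x * l x)) with (fun x => (p x * q x) * l x).
    + apply (prods_cons _ l (fun x => p x * q x)); assumption.
    + apply functional_extensionality; intros; lra.
Qed.

Lemma prods_bounded X (Y : X -> Prop) (Aff : (X -> R) -> Prop) p :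
  (forall l, Aff l -> bounded_on Y l) -> prods Aff p -> bounded_on Y p.
Proof.
  intros HA; induction 1; [apply bounded_on_const | apply bounded_on_mult; auto].
Qed.

(** * Universality over an abstract family of affine functionals *)

Section Networks.
Context {X : Type} (Y : X -> Prop) (Aff : (X -> R) -> Prop).
Hypothesis Aff_const : forall c, Aff (fun _ => c).
Hypothesis Aff_plus : forall l m, Aff l -> Aff m -> Aff (fun x => l x + m x).
Hypothesis Aff_scal : forall c l, Aff l -> Aff (fun x => c * l x).
Hypothesis Aff_bounded : forall l, Aff l -> bounded_on Y l.

(** The increment of [P] over a step [h] is a uniform limit of Riemann sums of [f], whose terms are
    [f] composed with translates of [l], again affine. *)
Lemma cl_span_primitive (S : (X -> R) -> Prop) (q : X -> R) (P f : R -> R) h :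
  bounded_on Y q -> continuity f -> (forall x, is_derive P x (f x)) ->
  (forall l, Aff l -> cl_span Y S (fun x => q x * f (l x))) ->
  forall l, Aff l -> cl_span Y S (fun x => q x * fdiff h P (l x)).
Proof.
  intros (Q & HQ & Hq) Hf HP HS l Hl.
  destruct (Aff_bounded l Hl) as (C & HC & Hb).
  apply cl_span_lim; intros e He; assert (Hh := Rabs_pos h).
  (* The nodes stay within [C + Rabs h], and the step errors add up to [Q * eta * Rabs h], at most
     [e]; the added 1 allows [h = 0]. *)
  destruct (uniform_derivative P f (C + Rabs h) (e / (Q * (Rabs h + 1))) HP Hf)
    as (del & Hdel & Hu).
  { apply Rdiv_lt_0_compat; nra. }
  destruct (inv_INR_S_small (del / (Rabs h + 1))) as [N HN].
  { apply Rdiv_lt_0_compat; lra. }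
  specialize (HN N (Nat.le_refl N)).
  assert (HN0 : 0 < INR (Datatypes.S N)) by (apply lt_0_INR; lia).
  set (n := Datatypes.S N) in *; clearbody n.
  set (tau := h / INR n).
  assert (Ht : Rabs tau = Rabs h * / INR n).
  { unfold tau, Rdiv; rewrite Rabs_mult, (Rabs_pos_eq (/ _)); [reflexivity|].
    left; apply Rinv_0_lt_compat, HN0. }
  assert (Hnt : INR n * Rabs tau = Rabs h) by (rewrite Ht; field; lra).
  exists (fun x => q x * riemann f tau (l x) n); split.
  (* The step is generalised before the induction because [tau] depends on [n]. *)
  - clear Hnt Ht HN; generalize tau; intros t.
    clear HN0; induction n as [|m IH]; simpl.
    + apply (cl_span_ext_on Y S (fun _ => 0)); [intros; lra | apply cl_span_zero].
    + apply (cl_span_ext_on Y S (fun x =>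
        q x * riemann f t (l x) m + t * (q x * f (l x + INR m * t)))); [intros; lra|].
      apply cl_span_plus; [exact IH|]; apply cl_span_scal.
      apply (HS (fun x => l x + INR m * t)), Aff_plus; auto.
  - intros x Hx; specialize (Hb x Hx); specialize (Hq x Hx).
    assert (HR := riemann_primitive P f (C + Rabs h) _ del tau (l x) n Hu).
    unfold fdiff; replace (l x + h) with (l x + INR n * tau) by (unfold tau; field; lra).
    rewrite <- Rmult_minus_distr_l, Rabs_mult.
    apply Rle_trans with (Q * (INR n * (e / (Q * (Rabs h + 1)) * Rabs tau))).
    + apply Rmult_le_compat; auto using Rabs_pos.
      apply HR; [lra|]; rewrite Ht.
      apply Rle_trans with ((Rabs h + 1) * (del / (Rabs h + 1))); [|right; field; lra].
      apply Rmult_le_compat; try lra; left; apply Rinv_0_lt_compat, HN0.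
    + replace (Q * (INR n * (e / (Q * (Rabs h + 1)) * Rabs tau)))
        with (Q * (e / (Q * (Rabs h + 1))) * Rabs h) by (rewrite <- Hnt; lra).
      apply Rle_trans with (Q * (e / (Q * (Rabs h + 1))) * (Rabs h + 1)).
      * apply Rmult_le_compat_l; [|lra].
        left; apply Rmult_lt_0_compat; [lra|]; apply Rdiv_lt_0_compat; nra.
      * right; field; lra.
Qed.

(* Differentiating [q (fdiff h P o (l + s m))] in [s] at [s = 0], where [P' = f],
   brings out the factor [m]. *)
Lemma cl_span_fdiff (S : (X -> R) -> Prop) (q : X -> R) (f : R -> R) h :
  bounded_on Y q -> continuity f ->
  (forall l, Aff l -> cl_span Y S (fun x => q x * f (l x))) ->
  forall l m, Aff l -> Aff m -> cl_span Y S (fun x => q x * m x * fdiff h f (l x)).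
Proof.
  intros HQ Hf HS l m Hl Hm.
  destruct (continuous_primitive f Hf) as [P HP].
  assert (HSP := cl_span_primitive S q P f h HQ Hf HP HS).
  destruct HQ as (Q & HQ & Hq).
  destruct (Aff_bounded l Hl) as (C & HC & Hb).
  destruct (Aff_bounded m Hm) as (D & HD & Hd).
  apply cl_span_lim; intros e He.
  destruct (uniform_derivative (fdiff h P) (fdiff h f) (C + D) (e / (Q * D))
    (fdiff_derive h P f HP) (fdiff_continuity h f Hf)) as (del & Hdel & Hu).
  { apply Rdiv_lt_0_compat; nra. }
  (* The bound 1 keeps [l + s * m] within [C + D], and [del / D] keeps the increment [s * m] within
     [del]. *)
  set (s := Rmin 1 (del / D)).
  assert (Hs : 0 < s <= 1 /\ s * D <= del).
  { assert (H0 : 0 < del / D) by (apply Rdiv_lt_0_compat; lra).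
    assert (H1 : s <= del / D) by apply Rmin_r.
    split; [split; [apply Rmin_pos; lra | apply Rmin_l]|].
    replace del with (del / D * D) by (field; lra).
    apply Rmult_le_compat_r; lra. }
  exists (fun x => / s * (q x * fdiff h P (l x + s * m x) - q x * fdiff h P (l x))); split.
  - apply cl_span_scal, cl_span_minus; [|apply HSP, Hl].
    apply (HSP (fun x => l x + s * m x)), Aff_plus; auto.
  - intros x Hx; specialize (Hb x Hx); specialize (Hq x Hx); specialize (Hd x Hx).
    assert (Hsm : Rabs (s * m x) = s * Rabs (m x)) by (rewrite Rabs_mult, Rabs_pos_eq; lra).
    assert (Hm0 := Rabs_pos (m x)).
    assert (Hu' : Rabs (fdiff h P (l x + s * m x) - fdiff h P (l x)
      - s * m x * fdiff h f (l x)) <= e / (Q * D) * Rabs (s * m x)).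
    { apply Hu.
      - lra.
      - eapply Rle_trans; [apply Rabs_triang|]; rewrite Hsm; nra.
      - rewrite Hsm; nra. }
    replace (/ s * (q x * fdiff h P (l x + s * m x) - q x * fdiff h P (l x))
        - q x * m x * fdiff h f (l x))
      with (q x * (/ s * (fdiff h P (l x + s * m x) - fdiff h P (l x)
        - s * m x * fdiff h f (l x)))) by (field; lra).
    assert (Hsi : 0 < / s) by (apply Rinv_0_lt_compat; lra).
    rewrite 2!Rabs_mult, (Rabs_pos_eq (/ s)) by lra.
    apply Rle_trans with (Q * (/ s * (e / (Q * D) * (s * D)))); [|right; field; lra].
    apply Rmult_le_compat; auto using Rabs_pos.
    { apply Rmult_le_pos; [lra | apply Rabs_pos]. }
    apply Rmult_le_compat_l; [lra|].
    eapply Rle_trans; [exact Hu'|]; rewrite Hsm.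
    apply Rmult_le_compat_l; [|apply Rmult_le_compat_l; lra].
    left; apply Rdiv_lt_0_compat; nra.
Qed.

Definition neurons (g : R -> R) (s : X -> R) : Prop :=
  exists l, Aff l /\ s = (fun x => g (l x)).

(** Each affine factor of [p] costs one difference of [g], by [cl_span_fdiff]; hence [k] counts the
    factors. *)
Lemma cl_span_neurons_fdiffs g p : continuity g -> prods Aff p ->
  exists k, forall hs, length hs = k -> forall l, Aff l ->
    cl_span Y (neurons g) (fun x => p x * fdiffs hs g (l x)).
Proof.
  intros Hg; induction 1 as [|m p Hm Hp [k IH]].
  - exists O; intros [|h hs] Hhs l Hl; [|discriminate]; simpl.
    apply (cl_span_ext_on Y _ (fun x => g (l x))); [intros; lra|].
    apply cl_span_incl; exists l; auto.
  - exists (S k); intros [|h hs] Hhs l Hl; [discriminate|].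
    apply cl_span_fdiff; auto.
    + apply (prods_bounded _ _ Aff); assumption.
    + apply fdiffs_continuity, Hg.
Qed.

(** At the constant functional [b] the difference of [g] is a nonzero number, and dividing by it
    leaves the product [p] alone. *)
Lemma cl_span_neurons_prods g : continuity g -> ~ is_polynomial g ->
  forall f, cl_span Y (prods Aff) f -> cl_span Y (neurons g) f.
Proof.
  intros Hg Hn f; apply cl_span_trans; intros p Hp.
  destruct (cl_span_neurons_fdiffs g p Hg Hp) as [k Hk].
  destruct (nonpolynomial_fdiffs_nonzero g Hg Hn k) as (hs & b & Hhs & Hb).
  apply (cl_span_ext_on Y _ (fun x => / fdiffs hs g b * (p x * fdiffs hs g b))).
  - intros x _; field; exact Hb.
  - apply cl_span_scal; exact (Hk hs Hhs (fun _ => b) (Aff_const b)).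
Qed.
End Networks.

(** All outputs must share one hidden layer: the neurons of a new output are put in front of the
    layer, with coefficient 0 in the other outputs, and it ignores the old neurons. *)
Lemma span_neurons_network X (Aff : (X -> R) -> Prop) g M (H : Fin.t M -> X -> R) :
  (forall i, span (neurons Aff g) (H i)) ->
  exists N (L : Fin.t N -> X -> R) (C : Fin.t M -> Fin.t N -> R),
    (forall j, Aff (L j)) /\ forall i x, H i x = fsum (fun j => C i j * g (L j x)).
Proof.
  induction M as [|M IH]; intros HH.
  - exists O, (fun j => Fin.case0 _ j), (fun i => Fin.case0 _ i).
    split; intros i; inversion i.
  - destruct (IH (fun i => H (Fin.FS i)) (fun i => HH _)) as (N & L & C & HL & HC).
    assert (Hhead : forall h, span (neurons Aff g) h ->
      exists N (L : Fin.t N -> X -> R) (c : Fin.t N -> R) (C : Fin.t M -> Fin.t N -> R),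
        (forall j, Aff (L j)) /\ (forall x, h x = fsum (fun j => c j * g (L j x))) /\
        forall i x, H (Fin.FS i) x = fsum (fun j => C i j * g (L j x))).
    { induction 1 as [|a s h (l & Hl & ->) _ (N' & L' & c' & C' & HL' & Hc' & HC')].
      - exists N, L, (fun _ => 0), C; repeat split; auto.
        intros x; rewrite (fsum_ext _ _ (fun _ => 0)), fsum_const; [lra | intros; lra].
      - exists (S N'), (fun j => Fin.caseS' j (fun _ => X -> R) l L'),
          (fun j => Fin.caseS' j (fun _ => R) a c'),
          (fun i j => Fin.caseS' j (fun _ => R) 0 (C' i)).
        split; [|split].
        + intros j; apply (Fin.caseS' j); auto.
        + intros x; simpl; rewrite Hc'; reflexivity.
        + intros i x; simpl; rewrite HC'; lra. }
    destruct (Hhead _ (HH Fin.F1)) as (N' & L' & c' & C' & HL' & Hc' & HC').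
    exists N', L', (fun i => Fin.caseS' i (fun _ => Fin.t N' -> R) c' C').
    split; [exact HL'|]; intros i; apply (Fin.caseS' i); auto.
Qed.

(** * Sample factorizations *)

(** The neighbourhood filter of [x] in [K], which turns [cont_on] into [filterlim]. *)
Definition near_pt {d : nat} {K : vecR d -> Prop} (x : ptK K) (P : ptK K -> Prop) : Prop :=
  exists del, 0 < del /\
    forall y : ptK K, (forall i, Rabs (proj1_sig y i - proj1_sig x i) < del) -> P y.

#[local] Instance near_pt_filter {d : nat} {K : vecR d -> Prop} (x : ptK K) : Filter (near_pt x).
Proof.
  constructor.
  - exists 1; split; [lra | auto].
  - intros P Q (a & Ha & HP) (b & Hb & HQ); exists (Rmin a b); split; [apply Rmin_pos; auto|].
    intros y Hy; split; [apply HP | apply HQ]; intros i; eapply Rlt_le_trans;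
      try apply Hy; [apply Rmin_l | apply Rmin_r].
  - intros P Q HPQ (a & Ha & HP); exists a; auto.
Qed.

Lemma cont_on_filterlim d (K : vecR d -> Prop) (f : ptK K -> R) :
  cont_on f <-> forall x, filterlim f (near_pt x) (locally (f x)).
Proof.
  split; intros H x.
  - intros P [eps HP]; destruct (H x eps (cond_pos eps)) as (del & Hdel & Hf).
    exists del; split; [exact Hdel|]; intros y Hy; apply HP, (Hf y Hy).
  - intros eps He; exact (H x _ (locally_ball (f x) (mkposreal eps He))).
Qed.

Lemma cont_on_const d (K : vecR d -> Prop) c : cont_on (fun _ : ptK K => c).
Proof. apply cont_on_filterlim; intros x; apply filterlim_const. Qed.

Lemma cont_on_plus d (K : vecR d -> Prop) (f g : ptK K -> R) :
  cont_on f -> cont_on g -> cont_on (fun x => f x + g x).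
Proof.
  rewrite 3!cont_on_filterlim; intros Hf Hg x.
  exact (filterlim_comp_2 f g Rplus (Hf x) (Hg x)
    (filterlim_plus (V := R_NormedModule) (f x) (g x))).
Qed.

Lemma cont_on_mult d (K : vecR d -> Prop) (f g : ptK K -> R) :
  cont_on f -> cont_on g -> cont_on (fun x => f x * g x).
Proof.
  rewrite 3!cont_on_filterlim; intros Hf Hg x.
  exact (filterlim_comp_2 f g Rmult (Hf x) (Hg x)
    (filterlim_mult (K := R_AbsRing) (f x) (g x))).
Qed.

Lemma cont_on_inv d (K : vecR d -> Prop) (f : ptK K -> R) :
  (forall x, f x <> 0) -> cont_on f -> cont_on (fun x => / f x).
Proof.
  rewrite 2!cont_on_filterlim; intros H0 Hf x.
  apply (filterlim_comp _ _ _ f Rinv _ _ _ (Hf x)).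
  apply continuity_pt_filterlim, (continuity_pt_inv (fun y => y)); [|apply H0].
  apply continuity_pt_id.
Qed.

Lemma cont_on_fsum d (K : vecR d -> Prop) n (u : Fin.t n -> ptK K -> R) :
  (forall i, cont_on (u i)) -> cont_on (fun x => fsum (fun i => u i x)).
Proof.
  induction n as [|n IH]; intros H; simpl; [apply cont_on_const|].
  apply cont_on_plus; [apply H | apply (IH (fun i => u (Fin.FS i))); intros; apply H].
Qed.

Definition pdist {d : nat} {K : vecR d -> Prop} (x y : ptK K) : R :=
  dist1 (proj1_sig x) (proj1_sig y).

Lemma cont_on_hat d (K : vecR d -> Prop) r (p : ptK K) : cont_on (fun x => hat r (pdist x p)).
Proof.
  intros x eps He; destruct (dist1_lt d eps He) as (c & Hc & Hd).
  exists c; split; [exact Hc|]; intros y Hy.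
  eapply Rle_lt_trans; [apply dist1_hat_lipschitz | apply Hd, Hy].
Qed.

(** Two late terms of a convergent subsequence are closer than [r], so no infinite separated
    sequence exists. Separation is kept because sampling after reconstruction must be the
    identity. *)
Lemma compact_set_net d (K : vecR d -> Prop) r : compact_set K -> 0 < r ->
  exists (n : nat) (p : Fin.t n -> ptK K),
    (forall i j, i <> j -> r <= pdist (p i) (p j)) /\
    forall x, exists i, pdist x (p i) < r.
Proof.
  intros HK Hr.
  destruct (finite_separated_net (ptK K) (fun _ => True) (fun x y => pdist x y < r))
    as (n & p & _ & Hsep & Hnet).
  - intros x y; unfold pdist; rewrite dist1_sym; auto.
  - intros s _.
    destruct (HK (fun n => proj1_sig (s n)) (fun n => proj2_sig (s n)))
      as (phi & y & Hphi & _ & Hlim).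
    destruct (dist1_lt d (r / 2)) as (c & Hc & Hd); [lra|].
    destruct (Hlim c Hc) as [N HN].
    exists (phi N), (phi (S N)); split; [apply Hphi|].
    assert (H1 := Hd _ _ (HN N (Nat.le_refl N))).
    assert (H2 := Hd _ _ (HN (S N) (Nat.le_succ_diag_r N))).
    assert (H3 := dist1_triang _ (proj1_sig (s (phi (S N)))) y (proj1_sig (s (phi N)))).
    rewrite (dist1_sym _ y) in H3; unfold pdist; lra.
  - exists n, p; split; [|auto].
    intros i j Hij; apply Rnot_lt_le, Hsep, Hij.
Qed.

(** * Compact sets of continuous functions and continuous operators *)

Lemma sup_lt_pointwise d (K : vecR d -> Prop) u r (x : ptK K) : sup_lt K u r -> Rabs (u x) < r.
Proof. intros (c & Hc & H); eapply Rle_lt_trans; [apply H | exact Hc]. Qed.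

(** Otherwise there are functions in [E] oscillating by more than [e] between points at distance
    below [/ INR (S n)]. Extract a uniform limit [h], then a limit point [z]; continuity of [h] at
    [z] is contradicted. *)
Lemma compact_CK_equicontinuous d (K : vecR d -> Prop) (E : CK K -> Prop) :
  compact_set K -> compact_CK E -> forall e, 0 < e -> exists r, 0 < r /\
    forall f x y, E f -> pdist x y < r -> Rabs (ev f x - ev f y) <= e.
Proof.
  intros HK HE e He; apply NNPP; intros Hno.
  assert (Hbad : forall n, exists t : CK K * (ptK K * ptK K),
    E (fst t) /\ pdist (fst (snd t)) (snd (snd t)) < / INR (S n) /\
    e < Rabs (ev (fst t) (fst (snd t)) - ev (fst t) (snd (snd t)))).
  { intros n; apply NNPP; intros Hn; apply Hno; exists (/ INR (S n)); split.
    - apply Rinv_0_lt_compat, lt_0_INR; lia.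
    - intros f x y Hf Hxy; apply Rnot_lt_le; intros Hlt; apply Hn.
      exists (f, (x, y)); auto. }
  set (t := fun n => proj1_sig (constructive_indefinite_description _ (Hbad n))).
  assert (Ht : forall n, E (fst (t n)) /\
    pdist (fst (snd (t n))) (snd (snd (t n))) < / INR (S n) /\
    e < Rabs (ev (fst (t n)) (fst (snd (t n))) - ev (fst (t n)) (snd (snd (t n))))).
  { intros n; exact (proj2_sig (constructive_indefinite_description _ (Hbad n))). }
  clearbody t; clear Hbad Hno.
  destruct (HE (fun n => fst (t n)) (fun n => proj1 (Ht n))) as (phi & h & Hphi & _ & Hh).
  destruct (HK (fun n => proj1_sig (fst (snd (t (phi n)))))
    (fun n => proj2_sig (fst (snd (t (phi n)))))) as (chi & z & Hchi & Hz & Hlim).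
  (* Four differences are chained: from [f] to [h] at [x] and at [y], and from each of these points
     to [z] along [h]. *)
  destruct (proj2_sig h (exist _ z Hz) (e / 4)) as (del & Hdel & Hcont); [lra|].
  destruct (Hh (e / 4)) as [N1 HN1]; [lra|].
  destruct (Hlim (del / 2)) as [N2 HN2]; [lra|].
  destruct (inv_INR_S_small (del / 2)) as [N3 HN3]; [lra|].
  set (n := (N1 + N2 + N3)%nat).
  assert (Hc := strictly_increasing_ge _ Hchi n).
  assert (Hp := strictly_increasing_ge _ Hphi (chi n)).
  specialize (HN1 (chi n) ltac:(lia)); specialize (HN2 n ltac:(lia)).
  specialize (HN3 (phi (chi n)) ltac:(lia)).
  destruct (Ht (phi (chi n))) as (_ & Hd & Hbig).
  destruct (t (phi (chi n))) as [f [x y]]; simpl in *.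
  assert (H1 := sup_lt_pointwise _ _ _ _ x HN1).
  assert (H2 := sup_lt_pointwise _ _ _ _ y HN1).
  assert (H3 : Rabs (ev h x - ev h (exist _ z Hz)) < e / 4).
  { apply Hcont; intros i; simpl; specialize (HN2 i); lra. }
  assert (H4 : Rabs (ev h y - ev h (exist _ z Hz)) < e / 4).
  { apply Hcont; intros i; simpl; specialize (HN2 i).
    assert (H := dist1_coord _ (proj1_sig x) (proj1_sig y) i); unfold pdist in Hd.
    replace (proj1_sig y i - z i)
      with ((proj1_sig x i - z i) - (proj1_sig x i - proj1_sig y i)) by lra.
    eapply Rle_lt_trans; [apply Rabs_triang|]; rewrite Rabs_Ropp; lra. }
  apply Rlt_not_le in Hbig; apply Hbig.
  apply Rabs_lt_between in H1, H2, H3, H4; apply Rabs_le; lra.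
Qed.

(** For bad pairs at distance tending to 0, compactness makes both members accumulate at one [f0],
    and continuity of [F] at [f0] is contradicted. *)
Lemma cont_op_uniform_near_compact d d' (K : vecR d -> Prop) (K' : vecR d' -> Prop)
  (F : CK K -> CK K') (E : CK K -> Prop) :
  cont_op F -> compact_CK E -> forall e, 0 < e -> exists del, 0 < del /\
    forall f h, E f -> (forall x, Rabs (ev h x - ev f x) <= del) ->
      forall y, Rabs (ev (F h) y - ev (F f) y) <= e.
Proof.
  intros HF HE e He; apply NNPP; intros Hno.
  assert (Hbad : forall n, exists t : CK K * CK K, E (fst t) /\
    (forall x, Rabs (ev (snd t) x - ev (fst t) x) <= / INR (S n)) /\
    exists y, e < Rabs (ev (F (snd t)) y - ev (F (fst t)) y)).
  { intros n; apply NNPP; intros Hn; apply Hno; exists (/ INR (S n)); split.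
    - apply Rinv_0_lt_compat, lt_0_INR; lia.
    - intros f h Hf Hfh y; apply Rnot_lt_le; intros Hlt; apply Hn.
      exists (f, h); eauto. }
  set (t := fun n => proj1_sig (constructive_indefinite_description _ (Hbad n))).
  assert (Ht : forall n, E (fst (t n)) /\
    (forall x, Rabs (ev (snd (t n)) x - ev (fst (t n)) x) <= / INR (S n)) /\
    exists y, e < Rabs (ev (F (snd (t n))) y - ev (F (fst (t n))) y)).
  { intros n; exact (proj2_sig (constructive_indefinite_description _ (Hbad n))). }
  clearbody t; clear Hbad Hno.
  destruct (HE (fun n => fst (t n)) (fun n => proj1 (Ht n))) as (phi & f0 & Hphi & _ & Hf0).
  destruct (HF f0 (e / 2)) as (del & Hdel & HFdel); [lra|].
  destruct (Hf0 (del / 2)) as [N1 HN1]; [lra|].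
  destruct (inv_INR_S_small (del / 2)) as [N2 HN2]; [lra|].
  set (n := (N1 + N2)%nat).
  assert (Hp := strictly_increasing_ge _ Hphi n).
  specialize (HN1 n ltac:(lia)); specialize (HN2 (phi n) ltac:(lia)).
  destruct (Ht (phi n)) as (_ & Hd & y & Hbig).
  destruct (t (phi n)) as [f h]; cbn [fst snd] in *.
  assert (H1 : sup_lt K (fun x => ev f x - ev f0 x) del).
  { destruct HN1 as (c & Hc & HN1); exists c; split; [lra | exact HN1]. }
  assert (H2 : sup_lt K (fun x => ev h x - ev f0 x) del).
  { destruct HN1 as (c & Hc & HN1); exists (/ INR (S (phi n)) + c); split; [lra|].
    intros x; replace (ev h x - ev f0 x) with ((ev h x - ev f x) + (ev f x - ev f0 x)) by lra.
    eapply Rle_trans; [apply Rabs_triang|]; specialize (Hd x); specialize (HN1 x); lra. }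
  apply HFdel in H1, H2.
  apply (fun u => sup_lt_pointwise _ _ u _ y) in H1.
  apply (fun u => sup_lt_pointwise _ _ u _ y) in H2.
  apply Rlt_not_le in Hbig; apply Hbig.
  apply Rabs_lt_between in H1, H2; apply Rabs_le; lra.
Qed.

Lemma cont_op_compact_image d d' (K : vecR d -> Prop) (K' : vecR d' -> Prop)
  (F : CK K -> CK K') (E : CK K -> Prop) :
  cont_op F -> compact_CK E -> compact_CK (fun h => exists f, E f /\ h = F f).
Proof.
  intros HF HE s Hs.
  set (f := fun n => proj1_sig (constructive_indefinite_description _ (Hs n))).
  assert (Hf : forall n, E (f n) /\ s n = F (f n)).
  { intros n; exact (proj2_sig (constructive_indefinite_description _ (Hs n))). }
  destruct (HE f (fun n => proj1 (Hf n))) as (phi & h & Hphi & Hh & Hlim).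
  exists phi, (F h); split; [exact Hphi|]; split; [eauto|].
  intros e He; destruct (HF h e He) as (del & Hdel & HFd).
  destruct (Hlim del Hdel) as [N HN]; exists N; intros n Hn.
  rewrite (proj2 (Hf (phi n))); apply HFd, HN, Hn.
Qed.

(* Reconstruction by a partition of unity made of hats of radius [r] around an
   [r]-separated net, so that each hat vanishes at the other nodes. *)
Lemma sample_factorization_exists d (K : vecR d -> Prop) (X : CK K -> Prop) delta :
  compact_set K -> compact_CK X -> 0 < delta ->
  exists (M : nat) (p : Fin.t M -> ptK K) (Ds : vecR M -> CK K),
    sample_factorization K X M delta (fun f i => ev f (p i)) Ds /\
    forall v w c, (forall i, Rabs (v i - w i) <= c) ->
      forall x, Rabs (ev (Ds v) x - ev (Ds w) x) <= c.
Proof.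
  intros HK HX Hdelta.
  destruct (compact_CK_equicontinuous _ _ _ HK HX (delta / 2)) as (r & Hr & Hequi); [lra|].
  (* The equicontinuity radius serves as net radius, separation and hat radius: some hat is positive
     at each point, and positive hats only see values of [f] within [delta / 2]. *)
  destruct (compact_set_net _ _ r HK Hr) as (M & p & Hsep & Hnet).
  set (w := fun i x => hat r (pdist x (p i))).
  assert (Hw : forall x i, 0 <= w i x) by (intros; apply hat_nonneg).
  assert (Hs : forall x, 0 < fsum (fun i => w i x)).
  { intros x; destruct (Hnet x) as [i Hi].
    apply Rlt_le_trans with (w i x).
    - eapply Rlt_le_trans; [|apply hat_lower]; lra.
    - apply (fsum_ge_term _ (fun i => w i x)), Hw. }
  set (rec := fun (v : vecR M) x => fsum (fun i => v i * (w i x / fsum (fun j => w j x)))).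
  assert (Hrec : forall v, cont_on (rec v)).
  { intros v; apply cont_on_fsum; intros i.
    apply cont_on_mult; [apply cont_on_const|].
    apply cont_on_mult; [apply cont_on_hat|].
    apply cont_on_inv; [intros x; apply Rgt_not_eq, Hs|].
    apply cont_on_fsum; intros j; apply cont_on_hat. }
  assert (Hplus : forall v v' x, rec (fun i => v i + v' i) x = rec v x + rec v' x).
  { intros v v' x; unfold rec; rewrite <- fsum_plus; apply fsum_ext; intros; lra. }
  assert (Hscal : forall a v x, rec (fun i => a * v i) x = a * rec v x).
  { intros a v x; unfold rec; rewrite <- fsum_scal; apply fsum_ext; intros; lra. }
  assert (Hcontr : forall v v' c, (forall i, Rabs (v i - v' i) <= c) ->
    forall x, Rabs (rec v x - rec v' x) <= c).
  { intros v v' c Hc x.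
    (* By linearity the difference is a weighted mean of [v - v'], compared with 0. *)
    replace (rec v x - rec v' x) with (rec (fun i => v i + -1 * v' i) x - 0)
      by (rewrite Hplus, Hscal; lra).
    apply (weighted_mean_close _ (fun i => w i x)); auto.
    intros i _; replace (v i + -1 * v' i - 0) with (v i - v' i) by lra; apply Hc. }
  exists M, p, (fun v => exist _ (rec v) (Hrec v)); split; [|exact Hcontr].
  split; [|split; [|split]].
  - split; [|split]; auto.
    intros f eps He; exists eps; split; [exact He|].
    intros h Hh i; exact (sup_lt_pointwise _ _ _ _ (p i) Hh).
  - split; [|split]; [exact Hplus | exact Hscal |].
    intros v eps He; exists (eps / 2); split; [lra|].
    intros v' Hv'; exists (eps / 2); split; [lra|].
    apply (Hcontr v' v); intros i; left; apply Hv'.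
  - intros v; apply functional_extensionality; intros i.
    change (rec v (p i) = v i); unfold rec.
    assert (H0 : forall j, j <> i -> w j (p i) = 0).
    { intros j Hj; apply hat_zero, Hsep; auto. }
    specialize (Hs (p i)); rewrite (fsum_single _ _ i H0) in *.
    rewrite (fsum_single _ _ i).
    + field; lra.
    + intros j Hj; rewrite H0 by exact Hj; unfold Rdiv; lra.
  - exists (delta / 2); split; [lra|]; intros f Hf x.
    apply (weighted_mean_close _ (fun i => w i x) (fun i => ev f (p i))); auto.
    intros i Hi; apply hat_pos in Hi; rewrite Rabs_minus_sym; auto.
Qed.

(** * Nets and affine functionals for the sample distance *)

Definition samples {d M : nat} {K : vecR d -> Prop} (p : Fin.t M -> ptK K) (f : CK K) : vecR M :=
  fun i => ev f (p i).

Lemma compact_CK_samples_net d (K : vecR d -> Prop) (E : CK K -> Prop) M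
  (p : Fin.t M -> ptK K) r : compact_CK E -> 0 < r ->
  exists n (u : Fin.t n -> CK K), (forall i, E (u i)) /\
    forall f, E f -> exists i, dist1 (samples p f) (samples p (u i)) < r.
Proof.
  intros HE Hr.
  destruct (finite_separated_net (CK K) E (fun f h => dist1 (samples p f) (samples p h) < r))
    as (n & u & HuE & _ & Hnet).
  - intros f h; rewrite dist1_sym; auto.
  - intros s Hs; destruct (HE s Hs) as (phi & h & Hphi & _ & Hlim).
    destruct (dist1_lt M (r / 2)) as (c & Hc & Hd); [lra|].
    destruct (Hlim c Hc) as [N HN].
    exists (phi N), (phi (S N)); split; [apply Hphi|].
    assert (Hn : forall n, (N <= n)%nat -> dist1 (samples p (s (phi n))) (samples p h) < r / 2).
    { intros n Hn; apply Hd; intros i; exact (sup_lt_pointwise _ _ _ _ (p i) (HN n Hn)). }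
    assert (H1 := Hn N (Nat.le_refl N)); assert (H2 := Hn (S N) (Nat.le_succ_diag_r N)).
    assert (H3 := dist1_triang _ (samples p (s (phi (S N)))) (samples p h) (samples p (s (phi N)))).
    rewrite (dist1_sym _ (samples p h)) in H3; lra.
  - exists n, u; auto.
Qed.

(** Each sample is within 1 of that of a node of a finite net; the sum over the nodes replaces a
    maximum. *)
Lemma compact_CK_bounded_samples d (K : vecR d -> Prop) (E : CK K -> Prop) M
  (p : Fin.t M -> ptK K) i : compact_CK E -> bounded_on E (fun f => samples p f i).
Proof.
  intros HE; destruct (compact_CK_samples_net _ _ _ _ p 1 HE) as (n & u & _ & Hnet); [lra|].
  assert (H0 : forall j, 0 <= Rabs (samples p (u j) i)) by (intros; apply Rabs_pos).
  exists (1 + fsum (fun j => Rabs (samples p (u j) i))); split.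
  - assert (H := fsum_nonneg _ _ H0); lra.
  - intros f Hf; destruct (Hnet f Hf) as [j Hj].
    assert (H1 := dist1_coord _ (samples p f) (samples p (u j)) i).
    assert (H2 := fsum_ge_term _ _ j H0); simpl in H2.
    replace (samples p f i)
      with ((samples p f i - samples p (u j) i) + samples p (u j) i) by lra.
    eapply Rle_trans; [apply Rabs_triang | lra].
Qed.

(** Stated on functions rather than on sample vectors, so that [E] itself is the set on which
    networks approximate. *)
Definition affine_samples {d M : nat} {K : vecR d -> Prop} (p : Fin.t M -> ptK K)
  (l : CK K -> R) : Prop :=
  exists (a : vecR M) (b : R), forall f, l f = fsum (fun i => a i * samples p f i) + b.

Lemma affine_samples_const d M (K : vecR d -> Prop) (p : Fin.t M -> ptK K) c :
  affine_samples p (fun _ => c).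
Proof.
  exists (fun _ => 0), c; intros f.
  rewrite fsum_scal; lra.
Qed.

Lemma affine_samples_plus d M (K : vecR d -> Prop) (p : Fin.t M -> ptK K) l m :
  affine_samples p l -> affine_samples p m -> affine_samples p (fun f => l f + m f).
Proof.
  intros (a & b & Hl) (a' & b' & Hm); exists (fun i => a i + a' i), (b + b'); intros f.
  rewrite Hl, Hm, (fsum_ext _ (fun i => (a i + a' i) * samples p f i)
    (fun i => a i * samples p f i + a' i * samples p f i)), fsum_plus by (intros; lra).
  lra.
Qed.

Lemma affine_samples_scal d M (K : vecR d -> Prop) (p : Fin.t M -> ptK K) c l :
  affine_samples p l -> affine_samples p (fun f => c * l f).
Proof.
  intros (a & b & Hl); exists (fun i => c * a i), (c * b); intros f.
  rewrite Hl, (fsum_ext _ (fun i => c * a i * samples p f i)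
    (fun i => c * (a i * samples p f i))), fsum_scal by (intros; lra).
  lra.
Qed.

Lemma affine_samples_coord d M (K : vecR d -> Prop) (p : Fin.t M -> ptK K) i :
  affine_samples p (fun f => samples p f i).
Proof.
  exists (fun j => if Fin.eq_dec j i then 1 else 0), 0; intros f.
  rewrite (fsum_single _ _ i).
  - destruct Fin.eq_dec; [lra | congruence].
  - intros j Hj; destruct Fin.eq_dec; [congruence | lra].
Qed.

Lemma affine_samples_bounded d M (K : vecR d -> Prop) (E : CK K -> Prop)
  (p : Fin.t M -> ptK K) l : compact_CK E -> affine_samples p l -> bounded_on E l.
Proof.
  intros HE (a & b & Hl); apply functional_extensionality in Hl; subst l.
  apply bounded_on_plus; [|apply bounded_on_const].
  apply (bounded_on_fsum _ _ _ (fun i f => a i * samples p f i)); intros i.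
  apply bounded_on_mult; [apply bounded_on_const | apply compact_CK_bounded_samples, HE].
Qed.

Lemma affine_map_fsum m n (A : Fin.t n -> vecR m) (b : vecR n) :
  affine_map (fun v j => fsum (fun i => A j i * v i) + b j).
Proof.
  intros t v w j.
  rewrite (fsum_ext _ _ (fun i => t * (A j i * v i) + (1 - t) * (A j i * w i))),
    fsum_plus, 2!fsum_scal by (intros; lra).
  lra.
Qed.

(* The interpolant [sum_i c_i w_i / sum_i w_i] with hats [w_i] in the sample
   distance around the nodes [u_i]: nets of radius [r / 2] and hats of radius [r]
   keep the denominator above [r / 2]. *)
Lemma cl_span_interpolant d M (K : vecR d -> Prop) (E : CK K -> Prop)
  (p : Fin.t M -> ptK K) r n (u : Fin.t n -> CK K) (c : Fin.t n -> R) :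
  compact_CK E -> 0 < r ->
  (forall f, E f -> exists i, dist1 (samples p f) (samples p (u i)) < r / 2) ->
  cl_span E (prods (affine_samples p)) (fun f =>
    fsum (fun i => c i * (hat r (dist1 (samples p f) (samples p (u i)))
      / fsum (fun j => hat r (dist1 (samples p f) (samples p (u j))))))).
Proof.
  intros HE Hr Hnet.
  set (P := prods (affine_samples p)).
  assert (HPm : forall s t, P s -> P t -> P (fun f => s f * t f)) by apply prods_mult.
  assert (HPb : forall s, P s -> bounded_on E s).
  { intros s; apply prods_bounded; intros l; apply affine_samples_bounded, HE. }
  assert (HP1 : P (fun _ => 1)) by constructor.
  assert (Hw : forall i, cl_span E P (fun f => hat r (dist1 (samples p f) (samples p (u i))))).
  { intros i; apply (cl_span_hat E P HPm HPb HP1).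
    apply (cl_span_fsum E P M (fun k f => Rabs (samples p f k - samples p (u i) k))); intros k.
    apply (cl_span_abs E P HPm HPb (fun f => samples p f k - samples p (u i) k)).
    apply cl_span_incl, prods_incl.
    apply (affine_samples_plus _ _ _ p _ (fun _ => - samples p (u i) k));
      [apply affine_samples_coord | apply affine_samples_const]. }
  apply (cl_span_fsum E P n (fun i f => c i * (hat r (dist1 (samples p f) (samples p (u i)))
    / fsum (fun j => hat r (dist1 (samples p f) (samples p (u j))))))); intros i.
  apply cl_span_scal, (cl_span_mult E P HPm HPb); [apply Hw|].
  apply (cl_span_inv E P HPm HPb HP1 _ (r / 2)); [lra | |].
  - intros f Hf; destruct (Hnet f Hf) as [j Hj].
    apply Rle_trans with (hat r (dist1 (samples p f) (samples p (u j)))).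
    + eapply Rle_trans; [|apply hat_lower]; lra.
    + apply (fsum_ge_term _ (fun j => hat r (dist1 (samples p f) (samples p (u j))))).
      intros; apply hat_nonneg.
  - apply (cl_span_fsum E P n (fun j f => hat r (dist1 (samples p f) (samples p (u j))))), Hw.
Qed.

Lemma network_approximation d M (K : vecR d -> Prop) (E : CK K -> Prop)
  (p : Fin.t M -> ptK K) (g : R -> R) M2 (G : Fin.t M2 -> CK K -> R) e :
  compact_CK E -> continuity g -> ~ is_polynomial g -> 0 < e ->
  (forall k, cl_span E (prods (affine_samples p)) (G k)) ->
  exists (N : nat) (T1 : vecR M -> vecR N) (T2 : vecR N -> vecR M2),
    affine_map T1 /\ affine_map T2 /\
    forall f, E f -> forall k, Rabs (T2 (fun j => g (T1 (samples p f) j)) k - G k f) <= e.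
Proof.
  intros HE Hg Hn He HG.
  assert (HH : forall k, exists h, span (neurons (affine_samples p) g) h /\
    close_on E e (G k) h).
  { intros k; refine (cl_span_neurons_prods E (affine_samples p) _ _ _ _ g Hg Hn _ (HG k) e He).
    - apply affine_samples_const.
    - apply affine_samples_plus.
    - apply affine_samples_scal.
    - intros l; apply affine_samples_bounded, HE. }
  set (H := fun k => proj1_sig (constructive_indefinite_description _ (HH k))).
  assert (HHs : forall k, span (neurons (affine_samples p) g) (H k) /\ close_on E e (G k) (H k)).
  { intros k; exact (proj2_sig (constructive_indefinite_description _ (HH k))). }
  destruct (span_neurons_network _ _ g M2 H (fun k => proj1 (HHs k))) as (N & L & C & HL & HC).
  set (A := fun j => proj1_sig (constructive_indefinite_description _ (HL j))).
  assert (HA : forall j, exists b, forall f, L j f = fsum (fun i => A j i * samples p f i) + b).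
  { intros j; exact (proj2_sig (constructive_indefinite_description _ (HL j))). }
  set (b := fun j => proj1_sig (constructive_indefinite_description _ (HA j))).
  assert (Hb : forall j f, L j f = fsum (fun i => A j i * samples p f i) + b j).
  { intros j; exact (proj2_sig (constructive_indefinite_description _ (HA j))). }
  (* [A] and [b] are the weights and biases of the hidden neurons; the output layer has bias 0. *)
  exists N, (fun v j => fsum (fun i => A j i * v i) + b j),
    (fun v k => fsum (fun j => C k j * v j) + 0).
  split; [apply affine_map_fsum|]; split; [apply (affine_map_fsum _ _ C (fun _ => 0))|].
  intros f Hf k; rewrite Rplus_0_r.
  rewrite (fsum_ext _ _ (fun j => C k j * g (L j f))) by (intros j; rewrite Hb; reflexivity).
  rewrite <- HC; apply (proj2 (HHs k) f Hf).
Qed.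

Theorem theorem5 (d d' : nat) (K : vecR d -> Prop) (K' : vecR d' -> Prop)
  (g : R -> R) (F : CK K -> CK K') (E : CK K -> Prop) :
  compact_set K -> compact_set K' ->
  continuity g -> ~ is_polynomial g ->
  cont_op F -> compact_CK E ->
  forall eps, 0 < eps ->
  exists (M1 : nat) (delta1 : R) (D1 : CK K -> vecR M1) (Ds1 : vecR M1 -> CK K),
    sample_factorization K E M1 delta1 D1 Ds1 /\
  exists (M2 : nat) (delta2 : R) (D2 : CK K' -> vecR M2) (Ds2 : vecR M2 -> CK K'),
    sample_factorization K' (fun h => exists f, E f /\ h = F f) M2 delta2 D2 Ds2 /\
  exists (N : nat) (T1 : vecR M1 -> vecR N) (T2 : vecR N -> vecR M2),
    affine_map T1 /\ affine_map T2 /\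
    exists c, c < eps /\
      forall f, E f -> forall x : ptK K',
        Rabs (ev (Ds2 (T2 (fun j => g (T1 (D1 f) j)))) x - ev (F f) x) <= c.
Proof.
  intros HK HK' Hg Hn HF HE eps He.
  (* One [eps / 4] each goes to the variation of [F], the reconstruction on the image and the
     network, which leaves room for a strict inequality. *)
  destruct (cont_op_uniform_near_compact _ _ _ _ F E HF HE (eps / 4)) as (del & Hdel & HFd);
    [lra|].
  destruct (sample_factorization_exists _ K E (del / 3) HK HE) as (M1 & p & Ds1 & HS1 & Hc1);
    [lra|].
  destruct (sample_factorization_exists _ K' _ (eps / 4) HK' (cont_op_compact_image _ _ _ _ F E HF HE))
    as (M2 & q & Ds2 & HS2 & Hc2); [lra|].
  exists M1, (del / 3), (samples p), Ds1; split; [exact HS1|].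
  exists M2, (eps / 4), (samples q), Ds2; split; [exact HS2|].
  destruct HS1 as (_ & _ & _ & c1 & Hc1lt & HS1), HS2 as (_ & _ & _ & c2 & Hc2lt & HS2).
  (* The net has half the hat radius [del / 3], as [cl_span_interpolant] requires. *)
  destruct (compact_CK_samples_net _ _ _ _ p (del / 3 / 2) HE) as (n & u & HuE & Hnet); [lra|].
  set (w := fun i f => hat (del / 3) (dist1 (samples p f) (samples p (u i)))).
  set (G := fun k f => fsum (fun i =>
    samples q (F (u i)) k * (w i f / fsum (fun j => w j f)))).
  assert (HG : forall k, cl_span E (prods (affine_samples p)) (G k)).
  { intros k; apply (cl_span_interpolant _ _ _ _ p (del / 3) n u (fun i => samples q (F (u i)) k));
      [exact HE | lra | exact Hnet]. }
  (* Closeness of samples gives closeness of functions: [f] and [u i] are each within [del / 3] of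
     their reconstructions, and [Ds1] is a contraction. *)
  assert (Hclose : forall f i, E f -> 0 < w i f ->
    forall y, Rabs (ev (F (u i)) y - ev (F f) y) <= eps / 4).
  { intros f i Hf Hi; apply HFd; [exact Hf|]; intros x.
    apply hat_pos in Hi.
    assert (H1 := HS1 f Hf x); assert (H2 := HS1 (u i) (HuE i) x).
    assert (H3 : Rabs (ev (Ds1 (samples p f)) x - ev (Ds1 (samples p (u i))) x) <= del / 3).
    { apply Hc1; intros j; left; eapply Rle_lt_trans; [apply dist1_coord | exact Hi]. }
    fold (samples p f) in H1; fold (samples p (u i)) in H2.
    apply Rabs_le_between in H1, H2, H3; apply Rabs_le; lra. }
  destruct (network_approximation _ _ _ E p g M2 G (eps / 4) HE Hg Hn) as
    (N & T1 & T2 & HT1 & HT2 & HT); [lra | exact HG |].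
  exists N, T1, T2; split; [exact HT1|]; split; [exact HT2|].
  exists (3 * (eps / 4)); split; [lra|]; intros f Hf x.
  assert (H2 := HS2 (F f) (ex_intro _ f (conj Hf eq_refl)) x).
  fold (samples q (F f)) in H2.
  assert (H3 : Rabs (ev (Ds2 (T2 (fun j => g (T1 (samples p f) j)))) x
    - ev (Ds2 (samples q (F f))) x) <= 2 * (eps / 4)).
  (* The network and interpolation errors are bounded at each sample; the contraction [Ds2] carries
     them to the sup norm. *)
  { apply Hc2; intros k; specialize (HT f Hf k).
    assert (H4 : Rabs (G k f - samples q (F f) k) <= eps / 4).
    { apply (weighted_mean_close _ (fun i => w i f)).
      - intros; apply hat_nonneg.
      - destruct (Hnet f Hf) as [i Hi].
        apply Rlt_le_trans with (w i f).
        + eapply Rlt_le_trans; [|apply hat_lower]; lra.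
        + apply (fsum_ge_term _ (fun i => w i f)); intros; apply hat_nonneg.
      - intros i Hi; apply (Hclose f i Hf Hi). }
    apply Rabs_le_between in HT, H4; apply Rabs_le; lra. }
  apply Rabs_le_between in H2, H3; apply Rabs_le; lra.
Qed.
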